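(* Let $\tau:\mathrm{Cl}(g)\to\mathrm{End}\,\Sigma$ be a spinor bundle, of Dirac type if $m$ is even and of Cartan type if $m$ is odd, on an $m$-dimensional Riemannian manifold $(M,g)$, and let $\tau^{\mathrm d}$ be the restriction of $\tau$ to the bundle of algebras $\mathrm{Cl}^{\mathrm d}(g)$, where $\mathrm{Cl}^{\mathrm d}(g)=\mathrm{Cl}(g)$ if $m$ is odd and $\mathrm{Cl}^{\mathrm d}(g)=\mathrm{Cl}^0(g)$ if $m$ is even. A necessary and sufficient condition for $\tau^{\mathrm d}$ to be decomposable is that $M$ be orientable.
   Context: Manifolds and maps are smooth and finite-dimensional. A Riemannian manifold $(M,g)$ is connected, with $g$ non-degenerate but not necessarily definite; $m\ge 1$. $\mathrm{Cl}(g_x)$ is the real Clifford algebra of $(T_xM,g_x)$ with $v^2=g_x(v)$, $\mathrm{Cl}^0(g_x)$ its even subalgebra; $\mathrm{Cl}(g)=\bigcup_x\mathrm{Cl}(g_x)$ and $\mathrm{Cl}^0(g)=\bigcup_x\mathrm{Cl}^0(g_x)$ are the corresponding bundles of algebras. For a quadratic space $(V,h)$ of even dimension $2n$, the Dirac representation is the faithful irreducible complex representation of $\mathrm{Cl}(h)$, of dimension $2^n$. For odd dimension $2n-1$, the Pauli representation is the faithful irreducible complex representation of $\mathrm{Cl}^0(h)$, of dimension $2^{n-1}$; it extends to two inequivalent representations $\sigma$ and $\sigma\circ\alpha$ of $\mathrm{Cl}(h)$, where $\alpha$ is the automorphism extending $v\mapsto -v$; the Cartan representation is $\sigma\oplus\sigma\circ\alpha$,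 of dimension $2^n$. A spinor bundle of Dirac type (resp. Cartan type) is a complex vector bundle $\Sigma\to M$ with a homomorphism of bundles of algebras $\tau:\mathrm{Cl}(g)\to\mathrm{End}\,\Sigma$ such that for every $x\in M$ the representation of $\mathrm{Cl}(g_x)$ in $\Sigma_x$ is equivalent to the Dirac (resp. Cartan) representation. A morphism of bundles of algebras $\tau:\mathcal{A}\to\mathrm{End}\,\Sigma$ over $M$ is decomposable if there are two (complex) vector bundles $\Sigma_+$, $\Sigma_-$ of positive fibre dimensions such that $\Sigma=\Sigma_+\oplus\Sigma_-$ and $\tau(\mathcal{A}_x)\Sigma_{\pm x}\subset\Sigma_{\pm x}$ for every $x\in M$. *)

(* Defs.v *)
From HB Require Import structures.
From mathcomp Require Import all_boot all_order all_algebra generic_quotient.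
From mathcomp Require Import all_classical all_reals all_analysis.
From mathcomp Require Import complex.
Set Implicit Arguments.
Unset Strict Implicit.
Unset Printing Implicit Defensive.
Import Order.TTheory GRing.Theory Num.Theory.
Import numFieldNormedType.Exports.
Local Open Scope classical_set_scope.
Local Open Scope quotient_scope.
Local Open Scope ring_scope.

(* The Clifford algebra of (V, q) is the associative unital K-algebra generated
   by the module V subject to v * v = q v; it is the quotient of the algebraic
   expressions in elements of K and V by the least congruence containing the
   axioms of K-algebras, the linearity of V -> Cl and the Clifford relation. *)

Section Clifford.
Variables (K : comNzRingType) (V : lmodType K) (q : V -> K).

Inductive clterm : Type :=
| ClCst of K
| ClGen of V
| ClAdd of clterm & clterm
| ClMul of clterm & clterm.

HB.instance Definition _ := gen_eqMixin clterm.
HB.instance Definition _ := gen_choiceMixin clterm.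

Inductive cleq : clterm -> clterm -> Prop :=
| cleq_refl t : cleq t t
| cleq_sym t u : cleq t u -> cleq u t
| cleq_trans t u v : cleq t u -> cleq u v -> cleq t v
| cleq_add t t' u u' : cleq t t' -> cleq u u' -> cleq (ClAdd t u) (ClAdd t' u')
| cleq_mul t t' u u' : cleq t t' -> cleq u u' -> cleq (ClMul t u) (ClMul t' u')
| cleq_addA t u v : cleq (ClAdd t (ClAdd u v)) (ClAdd (ClAdd t u) v)
| cleq_addC t u : cleq (ClAdd t u) (ClAdd u t)
| cleq_add0 t : cleq (ClAdd (ClCst 0) t) t
| cleq_mulA t u v : cleq (ClMul t (ClMul u v)) (ClMul (ClMul t u) v)
| cleq_mul1 t : cleq (ClMul (ClCst 1) t) t
| cleq_mul0 t : cleq (ClMul (ClCst 0) t) (ClCst 0)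
| cleq_mulDl t u v :
    cleq (ClMul (ClAdd t u) v) (ClAdd (ClMul t v) (ClMul u v))
| cleq_mulDr t u v :
    cleq (ClMul t (ClAdd u v)) (ClAdd (ClMul t u) (ClMul t v))
| cleq_cstD a b : cleq (ClCst (a + b)) (ClAdd (ClCst a) (ClCst b))
| cleq_cstM a b : cleq (ClCst (a * b)) (ClMul (ClCst a) (ClCst b))
| cleq_cstC a t : cleq (ClMul (ClCst a) t) (ClMul t (ClCst a))
| cleq_lin a v w :
    cleq (ClGen (a *: v + w)) (ClAdd (ClMul (ClCst a) (ClGen v)) (ClGen w))
| cleq_sqr v : cleq (ClMul (ClGen v) (ClGen v)) (ClCst (q v)).

Let cleqb t u := `[< cleq t u >].

Let cleqb_equiv : equiv_class_of cleqb.
Proof.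
split=> [t|t u|u t v].
- exact/asboolP/cleq_refl.
- by apply/asboolP/asboolP; apply: cleq_sym.
- by move=> /asboolP tu /asboolP uv; apply/asboolP/(cleq_trans tu uv).
Qed.

Definition cl_equiv : equiv_rel clterm := EquivRelPack cleqb_equiv.

Definition Cl : Type := {eq_quot cl_equiv}.

HB.instance Definition _ := Choice.on Cl.
HB.instance Definition _ := EqQuotient.on Cl.

Lemma cl_pi t u : cleq t u <-> \pi_Cl t = \pi_Cl u.
Proof.
by split=> [tu|/eqmodP/asboolP//]; apply/eqmodP/asboolP.
Qed.

Lemma cl_repr t : cleq (repr (\pi_Cl t)) t.
Proof. by apply/cl_pi; rewrite reprK. Qed.

Definition cl_cst (a : K) : Cl := \pi_Cl (ClCst a).
Definition cl_add (a b : Cl) : Cl := \pi_Cl (ClAdd (repr a) (repr b)).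
Definition cl_mul (a b : Cl) : Cl := \pi_Cl (ClMul (repr a) (repr b)).
Definition cl_opp (a : Cl) : Cl := cl_mul (cl_cst (- 1)) a.
Definition cl_scale (k : K) (a : Cl) : Cl := cl_mul (cl_cst k) a.

Definition cl_gen (v : V) : Cl := \pi_Cl (ClGen v).

Let pi_add t u : cl_add (\pi_Cl t) (\pi_Cl u) = \pi_Cl (ClAdd t u).
Proof. by apply/cl_pi/cleq_add; apply: cl_repr. Qed.

Let pi_mul t u : cl_mul (\pi_Cl t) (\pi_Cl u) = \pi_Cl (ClMul t u).
Proof. by apply/cl_pi/cleq_mul; apply: cl_repr. Qed.

Let addA : associative cl_add.
Proof. by elim/quotW=> t; elim/quotW=> u; elim/quotW=> v;
  rewrite (pi_add u v) (pi_add t u) !pi_add; apply/cl_pi/cleq_addA. Qed.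
Let addC : commutative cl_add.
Proof. by elim/quotW=> t; elim/quotW=> u;
  rewrite !pi_add; apply/cl_pi/cleq_addC. Qed.
Let add0 : left_id (cl_cst 0) cl_add.
Proof. by elim/quotW=> t; rewrite pi_add; apply/cl_pi/cleq_add0. Qed.
Let mulA : associative cl_mul.
Proof. by elim/quotW=> t; elim/quotW=> u; elim/quotW=> v;
  rewrite (pi_mul u v) (pi_mul t u) !pi_mul; apply/cl_pi/cleq_mulA. Qed.
Let mul1 : left_id (cl_cst 1) cl_mul.
Proof. by elim/quotW=> t; rewrite pi_mul; apply/cl_pi/cleq_mul1. Qed.
Let mul0 a : cl_mul (cl_cst 0) a = cl_cst 0.
Proof. by elim/quotW: a => t; rewrite pi_mul; apply/cl_pi/cleq_mul0. Qed.
Let mulDl : left_distributive cl_mul cl_add.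
Proof. by elim/quotW=> t; elim/quotW=> u; elim/quotW=> v;
  rewrite (pi_mul t v) (pi_mul u v) (pi_add t u) pi_add pi_mul;
  apply/cl_pi/cleq_mulDl. Qed.
Let mulDr : right_distributive cl_mul cl_add.
Proof. by elim/quotW=> t; elim/quotW=> u; elim/quotW=> v;
  rewrite (pi_mul t u) (pi_mul t v) (pi_add u v) pi_add pi_mul;
  apply/cl_pi/cleq_mulDr. Qed.
Let cstD a b : cl_cst (a + b) = cl_add (cl_cst a) (cl_cst b).
Proof. by rewrite pi_add; apply/cl_pi/cleq_cstD. Qed.
Let cstM a b : cl_cst (a * b) = cl_mul (cl_cst a) (cl_cst b).
Proof. by rewrite pi_mul; apply/cl_pi/cleq_cstM. Qed.
Let cstC a x : cl_mul (cl_cst a) x = cl_mul x (cl_cst a).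
Proof. by elim/quotW: x => t; rewrite !pi_mul; apply/cl_pi/cleq_cstC. Qed.
Let mulx1 : right_id (cl_cst 1) cl_mul.
Proof. by move=> a; rewrite -cstC mul1. Qed.
Let addN : left_inverse (cl_cst 0) cl_opp cl_add.
Proof. by move=> a; rewrite -[X in cl_add _ X]mul1 -mulDl -cstD addNr mul0. Qed.

HB.instance Definition _ := GRing.isZmodule.Build Cl addA addC add0 addN.
HB.instance Definition _ :=
  GRing.Zmodule_isPzRing.Build Cl mulA mul1 mulx1 mulDl mulDr.

Let scaleA a b v : cl_scale a (cl_scale b v) = cl_scale (a * b) v.
Proof. by rewrite /cl_scale cstM mulA. Qed.
Let scale1 : left_id 1 cl_scale.
Proof. exact: mul1. Qed.
Let scaleDr : right_distributive cl_scale +%R.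
Proof. by move=> a x y; exact: mulDr. Qed.
Let scaleDl v : {morph cl_scale^~ v : a b / a + b}.
Proof. by move=> a b; rewrite /cl_scale cstD; exact: mulDl. Qed.

HB.instance Definition _ :=
  GRing.Zmodule_isLmodule.Build K Cl scaleA scale1 scaleDr scaleDl.

Lemma cl_scaleE k (a : Cl) : k *: a = cl_cst k * a. Proof. by []. Qed.

Lemma cl_cstE k : cl_cst k = k *: (1 : Cl).
Proof. by rewrite cl_scaleE mulr1. Qed.

Lemma cl_scaleAl k (a b : Cl) : k *: (a * b) = (k *: a) * b.
Proof. exact: mulA. Qed.

Lemma cl_scaleAr k (a b : Cl) : k *: (a * b) = a * (k *: b).
Proof. by rewrite !cl_scaleE !mulrA [cl_cst k * a]cstC. Qed.

Lemma cl_gen_linear : linear cl_gen.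
Proof.
move=> a v w; rewrite cl_scaleE [RHS](_ : _ =
  \pi_Cl (ClAdd (ClMul (ClCst a) (ClGen v)) (ClGen w))).
  exact/cl_pi/cleq_lin.
by rewrite -pi_add -pi_mul.
Qed.

HB.instance Definition _ := GRing.isLinear.Build K V Cl *:%R cl_gen
  cl_gen_linear.

Lemma cl_gen_sqr v : cl_gen v * cl_gen v = q v *: (1 : Cl).
Proof. by rewrite -cl_cstE [LHS]pi_mul; apply/cl_pi/cleq_sqr. Qed.

Lemma cl_ind (P : Cl -> Prop) :
  (forall k, P (k *: (1 : Cl))) -> (forall v, P (cl_gen v)) ->
  (forall a b, P a -> P b -> P (a + b)) ->
  (forall a b, P a -> P b -> P (a * b)) ->
  forall a, P a.
Proof.
move=> Pc Pg PD PM; elim/quotW; elim=> [k|v|t Pt u Pu|t Pt u Pu].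
- by rewrite [\pi_Cl _]cl_cstE.
- exact: Pg.
- by rewrite -pi_add; exact: PD.
- by rewrite -pi_mul; exact: PM.
Qed.

(* In the universal property, a K-algebra is presented here as a ring B with a
   ring morphism from K to the centre of B. *)
Section Lift.
Variables (B : pzRingType) (kB : {rmorphism K -> B}) (f : V -> B).

Fixpoint clterm_eval t : B :=
  match t with
  | ClCst a => kB a
  | ClGen v => f v
  | ClAdd t u => clterm_eval t + clterm_eval u
  | ClMul t u => clterm_eval t * clterm_eval u
  end.

Definition cl_lift (a : Cl) : B := clterm_eval (repr a).

Hypothesis kB_central : forall k b, kB k * b = b * kB k.
Hypothesis f_linear : forall k v w, f (k *: v + w) = kB k * f v + f w.
Hypothesis f_sqr : forall v, f v * f v = kB (q v).

Lemma clterm_eval_cleq t u : cleq t u -> clterm_eval t = clterm_eval u.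
Proof.
elim=> //=; do ?[by move=> * ; congruence].
- by move=> *; rewrite addrA.
- by move=> *; rewrite addrC.
- by move=> *; rewrite rmorph0 add0r.
- by move=> *; rewrite mulrA.
- by move=> *; rewrite rmorph1 mul1r.
- by move=> *; rewrite rmorph0 mul0r.
- by move=> *; rewrite mulrDl.
- by move=> *; rewrite mulrDr.
- by move=> *; rewrite rmorphD.
- by move=> *; rewrite rmorphM.
Qed.

Let lift_pi t : cl_lift (\pi_Cl t) = clterm_eval t.
Proof. exact/clterm_eval_cleq/cl_repr. Qed.

Lemma cl_lift_gen v : cl_lift (cl_gen v) = f v.
Proof. exact: lift_pi. Qed.

Lemma cl_liftD a b : cl_lift (a + b) = cl_lift a + cl_lift b.
Proof. by elim/quotW: a => t; elim/quotW: b => u; rewrite [_ + _]pi_add !lift_pi. Qed.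

Lemma cl_liftM a b : cl_lift (a * b) = cl_lift a * cl_lift b.
Proof. by elim/quotW: a => t; elim/quotW: b => u; rewrite [_ * _ in LHS]pi_mul !lift_pi. Qed.

Lemma cl_liftZ k a : cl_lift (k *: a) = kB k * cl_lift a.
Proof. by rewrite cl_scaleE cl_liftM [cl_lift (cl_cst _)]lift_pi. Qed.

Lemma cl_lift1 : cl_lift 1 = 1.
Proof. by rewrite [LHS]lift_pi /= rmorph1. Qed.

Lemma cl_lift_unique (h : Cl -> B) :
  h 1 = 1 -> (forall k a, h (k *: a) = kB k * h a) ->
  (forall a b, h (a + b) = h a + h b) -> (forall a b, h (a * b) = h a * h b) ->
  (forall v, h (cl_gen v) = f v) -> h =1 cl_lift.
Proof.
move=> h1 hZ hD hM hg; elim/cl_ind=> [k|v|a b ha hb|a b ha hb].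
- by rewrite hZ cl_liftZ h1 cl_lift1.
- by rewrite hg cl_lift_gen.
- by rewrite hD cl_liftD ha hb.
- by rewrite hM cl_liftM ha hb.
Qed.

End Lift.

Lemma cl_cst_is_nmod_morphism : nmod_morphism cl_cst.
Proof. by split; [|exact: cstD]. Qed.
HB.instance Definition _ :=
  GRing.isNmodMorphism.Build K Cl cl_cst cl_cst_is_nmod_morphism.
Lemma cl_cst_is_monoid_morphism : monoid_morphism cl_cst.
Proof. by split; [|exact: cstM]. Qed.
HB.instance Definition _ :=
  GRing.isMonoidMorphism.Build K Cl cl_cst cl_cst_is_monoid_morphism.

Definition cl_alpha : Cl -> Cl := cl_lift cl_cst (fun v => - cl_gen v).

Lemma cl_alphaP : [/\ cl_alpha 1 = 1,
  forall k a, cl_alpha (k *: a) = k *: cl_alpha a,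
  {morph cl_alpha : a b / a + b}, {morph cl_alpha : a b / a * b} &
  forall v, cl_alpha (cl_gen v) = - cl_gen v].
Proof.
have lin k v w : - cl_gen (k *: v + w) = cl_cst k * - cl_gen v + - cl_gen w.
  by rewrite cl_gen_linear opprD mulrN.
have sqr v : - cl_gen v * - cl_gen v = cl_cst (q v).
  by rewrite mulrNN cl_gen_sqr cl_cstE.
split.
- exact: (cl_lift1 cstC lin sqr).
- exact: (cl_liftZ cstC lin sqr).
- exact: (cl_liftD cstC lin sqr).
- exact: (cl_liftM cstC lin sqr).
- exact: (cl_lift_gen cstC lin sqr).
Qed.

Inductive cl_even : set Cl :=
| cl_even_cst k : cl_even (k *: (1 : Cl))
| cl_even_gen v w : cl_even (cl_gen v * cl_gen w)
| cl_evenD a b : cl_even a -> cl_even b -> cl_even (a + b)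
| cl_evenM a b : cl_even a -> cl_even b -> cl_even (a * b).

End Clifford.

Section Representation.
Variables (R : realType) (V : lmodType R) (q : V -> R).
Local Notation C := R[i].

Definition is_rep (F : lmodType C) (S : set (Cl q)) (rho : Cl q -> F -> F) :=
  [/\ forall a, S a -> linear (rho a),
      forall a b, S a -> S b -> forall u, rho (a + b) u = rho a u + rho b u,
      forall k a, S a -> forall u, rho (k *: a) u = (k%:C)%C *: rho a u,
      forall a b, S a -> S b -> forall u, rho (a * b) u = rho a (rho b u) &
      forall u, rho 1 u = u].

Definition faithful (F : lmodType C) (S : set (Cl q)) (rho : Cl q -> F -> F) :=
  forall a b, S a -> S b -> (forall u, rho a u = rho b u) -> a = b.

Definition subspace (F : lmodType C) (W : set F) :=
  W 0 /\ forall k u v, W u -> W v -> W (k *: u + v).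

Definition irreducible (F : lmodType C) (S : set (Cl q))
    (rho : Cl q -> F -> F) :=
  (exists u : F, u <> 0) /\
  forall W : set F, subspace W ->
    (forall a u, S a -> W u -> W (rho a u)) -> W = [set 0] \/ W = setT.

Definition equivalent (E F : lmodType C)
    (rho : Cl q -> E -> E) (sigma : Cl q -> F -> F) :=
  exists T : E -> F,
    [/\ linear T, bijective T & forall a u, T (rho a u) = sigma a (T u)].

Definition is_Dirac (n : nat) (delta : Cl q -> 'cV[C]_(2 ^ n) -> 'cV[C]_(2 ^ n)) :=
  [/\ is_rep setT delta, faithful setT delta & irreducible setT delta].

Definition is_Pauli (n : nat) (pi0 : Cl q -> 'cV[C]_(2 ^ n) -> 'cV[C]_(2 ^ n)) :=
  [/\ is_rep (@cl_even _ _ q) pi0, faithful (@cl_even _ _ q) pi0 &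
      irreducible (@cl_even _ _ q) pi0].

Definition Cartan_sum (F : lmodType C) (sigma : Cl q -> F -> F) :
    Cl q -> (F * F)%type -> (F * F)%type :=
  fun a u => (sigma a u.1, sigma (cl_alpha a) u.2).

(* For dim V = 2n. *)
Definition Dirac_type (n : nat) (F : lmodType C) (rho : Cl q -> F -> F) :=
  exists delta : Cl q -> 'cV[C]_(2 ^ n) -> 'cV[C]_(2 ^ n),
    is_Dirac delta /\ equivalent delta rho.

(* For dim V = 2n + 1: sigma is an extension to Cl of the Pauli
   representation. *)
Definition Cartan_type (n : nat) (F : lmodType C) (rho : Cl q -> F -> F) :=
  exists sigma : Cl q -> 'cV[C]_(2 ^ n) -> 'cV[C]_(2 ^ n),
    [/\ is_rep setT sigma, is_Pauli sigma & equivalent (Cartan_sum sigma) rho].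

End Representation.

Section Smooth.
Variables (R : realType) (m : nat).

Fixpoint Ck (k : nat) (U : set 'rV[R]_m) (f : 'rV[R]_m -> R) : Prop :=
  match k with
  | 0%N => forall x, U x -> {for x, continuous f}
  | k.+1 => (forall x, U x -> differentiable f x) /\
            forall v, Ck k U ('D_v f)
  end.

Definition smooth (U : set 'rV[R]_m) (f : 'rV[R]_m -> R) :=
  forall k, Ck k U f.

(* A chart is a homeomorphism coord from the open set dom onto an open subset
   of R^m, with inverse param; both functions are total, and arbitrary outside
   these sets. *)
Record chart (M : topologicalType) := Chart {
  dom : set M;
  coord : M -> 'rV[R]_m;
  param : 'rV[R]_m -> M;
  dom_open : open dom;
  img_open : open (coord @` dom);
  coordK : forall x, dom x -> param (coord x) = x;
  coord_continuous : forall x, dom x -> {for x, continuous coord};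
  param_continuous : forall y, (coord @` dom) y -> {for y, continuous param}
}.

Section Charts.
Variable M : topologicalType.

Definition transition (c d : chart M) : 'rV[R]_m -> 'rV[R]_m :=
  coord d \o param c.

Definition compatible (c d : chart M) :=
  forall a, smooth (coord c @` (dom c `&` dom d))
                   (fun y => transition c d y 0 a).

(* At x in dom c `&` dom d; it maps the coordinates of a tangent vector in c to
   those in d, by multiplication on the right. *)
Definition chart_jac (c d : chart M) (x : M) : 'M[R]_m :=
  'J (transition c d) (coord c x).

End Charts.

Record manifold := Manifold {
  carrier :> topologicalType;
  mfd_hausdorff : hausdorff_space carrier;
  mfd_countable : @second_countable carrier;
  atlas_idx : Type;
  atlas : atlas_idx -> chart carrier;
  atlas_compatible : forall i j, compatible (atlas i) (atlas j);
  chart_idx_at : carrier -> atlas_idx;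
  chart_idx_atP : forall x, dom (atlas (chart_idx_at x)) x
}.

Section Manifold.
Variable M : manifold.

Definition chart_at (x : M) : chart M := atlas (chart_idx_at x).

Definition orientable :=
  exists (J : Type) (c : J -> chart M),
    [/\ forall j i, compatible (c j) (atlas i) /\ compatible (atlas i) (c j),
        forall x, exists j, dom (c j) x &
        forall j k x, dom (c j) x -> dom (c k) x ->
          0 < \det (chart_jac (c j) (c k) x)].

Definition msmooth (U : set M) (f : M -> R) :=
  forall i : atlas_idx M,
    smooth (coord (atlas i) @` (dom (atlas i) `&` U)) (f \o param (atlas i)).

Definition cmsmooth (U : set M) (p n : nat) (h : M -> 'M[R[i]]_(p, n)) :=
  forall a b, msmooth U (fun x => complex.Re (h x a b)) /\
              msmooth U (fun x => complex.Im (h x a b)).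

(* A tangent vector at x is given by its coordinates in the chart chart_at x. *)
Definition tangent (x : M) : lmodType R := 'rV[R]_m.

(* The a-th coordinate vector field of the chart c, for x in dom c. *)
Definition coord_field (c : chart M) (a : 'I_m) (x : M) : tangent x :=
  row a (chart_jac c (chart_at x) x).

(* A pseudo-Riemannian metric of any signature; gram x is the Gram matrix of
   the scalar product in tangent x. *)
Record metric := Metric {
  gram : M -> 'M[R]_m;
  gram_sym : forall x, (gram x)^T = gram x;
  gram_nondegenerate : forall x, gram x \in unitmx;
  gram_smooth : forall (i : atlas_idx M) (a b : 'I_m),
    msmooth (dom (atlas i)) (fun x =>
      (coord_field (atlas i) a x *m gram x
         *m (coord_field (atlas i) b x)^T) 0 0)
}.

Definition quad (g : metric) (x : M) (v : tangent x) : R :=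
  (v *m gram g x *m v^T) 0 0.

(* vframe j identifies C^rank with the fibres over the open set vdom j, and is
   arbitrary elsewhere. The rank is constant, as it is over a connected base. *)
Record cvbundle := CVBundle {
  vrank : nat;
  fibre :> M -> lmodType R[i];
  vidx : Type;
  vdom : vidx -> set M;
  vframe : vidx -> forall x, {linear 'cV[R[i]]_vrank -> fibre x};
  vdom_open : forall j, open (vdom j);
  vdom_cover : forall x, exists j, vdom j x;
  vframe_bij : forall j x, vdom j x -> bijective (vframe j x);
  vframe_smooth : forall j k, exists h : M -> 'M[R[i]]_vrank,
    cmsmooth (vdom j `&` vdom k) h /\
    forall x u, vdom j x -> vdom k x -> vframe j x u = vframe k x (h x *m u)
}.

Definition smooth_hom (P Q : cvbundle) (U : set M)
    (phi : forall x, P x -> Q x) :=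
  forall (j : vidx P) (k : vidx Q),
  exists h : M -> 'M[R[i]]_(vrank Q, vrank P),
    cmsmooth (U `&` vdom j `&` vdom k) h /\
    forall x u, U x -> vdom j x -> vdom k x ->
      phi x (vframe j x u) = vframe k x (h x *m u).

Section Spinor.
Variables (g : metric) (Sigma : cvbundle).

Definition Clg (x : M) := Cl (quad g (x := x)).

(* Over dom c, the products of coordinate vector fields in increasing order form
   a basis of Cl(g_x), and the smooth structure of Cl(g) is the one for which
   these are smooth local frames. *)
Definition Clg_frame (c : chart M) (I : {set 'I_m}) (x : M) : Clg x :=
  \prod_(a in I) cl_gen (quad g (x := x)) (coord_field c a x).

Definition algebra_bundle_hom (tau : forall x, Clg x -> Sigma x -> Sigma x) :=
  (forall x, is_rep setT (tau x)) /\
  forall (i : atlas_idx M) (I : {set 'I_m}),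
    smooth_hom (dom (atlas i))
      (fun x => tau x (Clg_frame (atlas i) I x)).

(* The restriction of tau to the bundle of subalgebras A is decomposable. *)
Definition decomposable (A : forall x, set (Clg x))
    (tau : forall x, Clg x -> Sigma x -> Sigma x) :=
  exists (P Q : cvbundle)
         (iP : forall x, P x -> Sigma x) (iQ : forall x, Q x -> Sigma x),
    [/\ (0 < vrank P)%N /\ (0 < vrank Q)%N,
        forall x, linear (iP x) /\ linear (iQ x),
        smooth_hom setT iP /\ smooth_hom setT iQ,
        forall x, bijective (fun w : (P x * Q x)%type => iP x w.1 + iQ x w.2) &
        forall x (a : Clg x), A x a ->
          (forall p, exists p', tau x a (iP x p) = iP x p') /\
          (forall p, exists p', tau x a (iQ x p) = iQ x p')].

Definition Cld (x : M) : set (Clg x) :=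
  if odd m then setT else @cl_even _ _ (quad g (x := x)).

End Spinor.
End Manifold.
End Smooth.

(* Main.v *)
Require Import Defs.
From HB Require Import structures.
From mathcomp Require Import all_boot all_order all_fingroup all_algebra.
From mathcomp Require Import all_classical all_reals all_analysis.
From mathcomp Require Import complex ring.
(* Imported again so that dom and coord denote charts, not their homonyms on
   morphisms and bases. *)
Require Import Defs.
Set Implicit Arguments.
Unset Strict Implicit.
Unset Printing Implicit Defensive.
Import Order.TTheory GRing.Theory Num.Theory.
Import numFieldNormedType.Exports.
Local Open Scope classical_set_scope.
Local Open Scope ring_scope.

(** Why orientability and decomposability are equivalent.

Write Cl^d for the algebra [Cld x] at a point [x], and [vol x] for the volume
element of the tangent space: up to a scalar, the product of the vectors of an
orthogonal basis. It lies in Cl^d, commutes with Cl^d, and its square is a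
non-zero real number. On the spinor space there is moreover an operator [T]
that normalises Cl^d, anticommutes with [vol x], has a non-zero scalar square,
and such that no proper non-zero subspace is invariant under both Cl^d and [T]
([chirality_swap]). For even m it is the Clifford product by a non-isotropic
vector, and the last property is the irreducibility of the Dirac
representation; for odd m it is the exchange of the two summands of the Cartan
representation, on which [vol x] acts by two opposite scalars, by Schur's lemma
applied to the Pauli representation. So [vol x] has two eigenspaces, which [T]
exchanges and which therefore have half the dimension ([involution_rank]), and
[vol x] acts by a scalar on any proper summand that is invariant under Cl^d
([volume_scalar_on_summand]).

Orientations enter because changing the frame multiplies the volume element by
the determinant of the change of frame ([volume_mul]). A tangent vector at [x]
has coordinates in a chart chosen at [x] without any regularity in [x], so
[vol x] itself is not smooth in [x]; what is smooth over a chart is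
[frame_vol], the volume element of its coordinate fields, and it differs from
[vol x] by the Jacobian determinant [frame_det]. Accordingly, an orientation is
encoded by a function [o] without zeros such that the sign of [o * frame_det]
is locally constant over every chart ([orientation_sign]). An oriented atlas
yields such a function ([orientable_sign]); conversely, restrict each chart to
the open set where the sign is positive, and compose it with a reflection on
the one where the sign is negative ([sign_orientable]).

Decomposable implies orientable ([decomposable_sign]): let [lam x] be the
scalar by which [vol x] acts on the first summand. Its square is real and
non-zero, so [lam x] is real or imaginary and [Re (lam x) + Im (lam x)] does
not vanish; this is [o x]. Over a chart, [frame_det * lam] is a quotient of
matrix entries of smooth homomorphisms, hence continuous, which makes the signs
locally constant.

Orientable implies decomposable ([sign_decomposable]): multiplying [vol x] by
the sign of [o x], by the inverse square root of the absolute value of its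
square and, if this square is negative, by the imaginary unit gives an
involution [chi] of the spinor bundle. It commutes with Cl^d and is smooth
([chi_coef_smooth]), and its two eigenspaces, having constant rank, form
smooth subbundles ([chi_local_frame], [subbundle_exists]). *)

(** * The volume element of a frame, in any ring generated by a quadratic space *)

Section Diagonalization.
Variable F : fieldType.
Hypothesis two_neq0 : 2%:R != 0 :> F.

(** By polarisation, since 2 is invertible. *)
Lemma sym_isotropic_eq0 n (G : 'M[F]_n) : G^T = G ->
  (forall v : 'rV_n, v *m G *m v^T = 0) -> G = 0.
Proof.
move=> Gs Gv; apply/matrixP => i j; rewrite mxE.
have E (u v : 'rV_n) : u *m G *m v^T = 0.
  have := Gv (u + v); rewrite linearD /= !mulmxDl !mulmxDr !Gv add0r addr0.
  have -> : v *m G *m u^T = u *m G *m v^T.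
    rewrite -[LHS]trmxK [X in X^T](mx11_scalar) tr_scalar_mx -mx11_scalar.
    by rewrite !trmx_mul trmxK Gs mulmxA.
  rewrite -mulr2n => /eqP; rewrite -scaler_nat scaler_eq0 (negPf two_neq0) /=.
  by move/eqP.
have /matrixP/(_ 0 0) := E (delta_mx 0 i) (delta_mx 0 j).
by rewrite -rowE trmx_delta -colE !mxE.
Qed.

(** A non-isotropic vector splits off orthogonally: complete it to a basis,
    clear the rest of its row and column by a unipotent matrix, and recurse on
    the remaining block. *)
Lemma sym_diagonalizable n (G : 'M[F]_n) : G^T = G ->
  exists2 P : 'M[F]_n, P \in unitmx & is_diag_mx (P *m G *m P^T).
Proof.
elim: n G => [|n IHn] G Gs.
  by exists 1%:M; rewrite ?unitmx1 //; apply/is_diag_mxP => -[].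
have [->|/eqP G0] := eqVneq G 0.
  by exists 1%:M; rewrite ?unitmx1 ?mulmx0 ?mul0mx ?mx0_is_diag.
have [v vGv] : exists v : 'rV_n.+1, v *m G *m v^T <> 0.
  by apply: contrapT => /forallNP Gv; apply: G0;
    apply: sym_isotropic_eq0 => // v; apply: contrapT.
(* An invertible matrix whose first row is proportional to [v]. *)
pose Q := row_ebase v.
have [a va] : exists a, v = a *: row 0 Q.
  have [w -> w0] : exists2 w : 'rV_n.+1, v = w *m Q & forall k, k != 0 -> w 0 k = 0.
    exists (col_ebase v *m pid_mx (\rank v)); first by rewrite mulmx_ebase.
    move=> k k0; rewrite (mx11_scalar (col_ebase v)) mul_scalar_mx !mxE.
    have /negPf-> : 0%N != k by apply: contraNneq k0 => k0; apply/eqP/val_inj.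
    by rewrite /= mulr0.
  exists (w 0 0); apply/rowP => j; rewrite !mxE (bigD1 0) //= big1 ?addr0 // => k k0.
  by rewrite w0 ?mul0r.
pose H : 'M[F]_(1 + n) := Q *m G *m Q^T.
have Hs : H^T = H by rewrite /H !trmx_mul trmxK Gs mulmxA.
have H00 : H 0 0 != 0.
  apply/eqP => h; apply: vGv; rewrite va linearZ /= -scalemxAr -!scalemxAl.
  rewrite tr_row.
  have -> : row 0 Q *m G *m col 0 Q^T = (H 0 0)%:M.
    by rewrite colE mulmxA -!row_mul -colE [LHS]mx11_scalar [in LHS]mxE [in LHS]mxE.
  by rewrite h raddf0 !scaler0.
have : Q *m G *m Q^T = H by []; clearbody H => HQ.
pose A := ulsubmx H; pose B := ursubmx H; pose D := drsubmx H.
have AE : A = (H 0 0)%:M.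
  by rewrite [A]mx11_scalar !mxE; congr (H _ _)%:M; apply/val_inj.
have HE : H = block_mx A B B^T D.
  by rewrite -[LHS]submxK trmx_ursub Hs.
have Ds : D^T = D by rewrite trmx_drsub Hs.
pose a0 := H 0 0.
pose L : 'M[F]_(1 + n) := block_mx 1%:M 0 (- a0^-1 *: B^T) 1%:M.
have LHL : L *m H *m L^T = block_mx A 0 0 (D - a0^-1 *: (B^T *m B)).
  rewrite HE /L tr_block_mx !mulmx_block !mul1mx !mul0mx !trmx0 !trmx1 !addr0.
  rewrite !mulmx1 !mulmx0 !addr0 linearZ /= trmxK -!scalemxAr -!scalemxAl.
  rewrite AE -/a0 mul_scalar_mx mul_mx_scalar !scalerA mulNr mulVf // !scaleN1r.
  by rewrite !addNr !mul0mx scaler0 add0r scaleNr [- _ + D]addrC.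
have [|P' P'u P'd] := IHn (D - a0^-1 *: (B^T *m B)).
  by rewrite linearB linearZ /= trmx_mul trmxK Ds.
pose P : 'M[F]_(1 + n) := block_mx 1%:M 0 0 P'.
exists (P *m L *m Q).
  have dP : \det P = \det P' by rewrite [LHS]det_ublock det1 mul1r.
  have dL : \det L = 1 by rewrite [LHS]det_lblock !det1 mulr1.
  by rewrite !unitmx_mul row_ebase_unit andbT !unitmxE dP dL unitr1 -unitmxE P'u.
have -> : (P *m L *m Q) *m G *m (P *m L *m Q)^T = P *m (L *m H *m L^T) *m P^T.
  by rewrite -HQ !trmx_mul !mulmxA.
rewrite LHL /P tr_block_mx !mulmx_block !mul1mx !mul0mx !trmx0 !trmx1.
rewrite !(mulmx0, mul0mx, mulmx1, mul1mx, addr0, add0r).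
by rewrite /is_true [LHS](@is_diag_block_mx _ 1 n 1 n) // !eqxx P'd AE mx11_is_diag.
Qed.
End Diagonalization.

Section Volume.
Variables (K : fieldType) (m : nat) (B : pzRingType) (c : {rmorphism K -> B}).
Variable gen : 'rV[K]_m -> B.
Hypothesis c_central : forall k b, c k * b = b * c k.
Hypothesis gen_linear : forall k v w, gen (k *: v + w) = c k * gen v + gen w.

(** The antisymmetrisation, without the factor 1 / m!, of the product of the
    rows of a frame. For an orthogonal frame it is m! times the product
    ([volume_orthogonal]). Coordinate fields are not orthogonal, and this form
    is both alternating in the frame and polynomial in its vectors; the first
    property relates different frames, the second one gives smoothness. *)
Definition volume (E : 'M[K]_m) : B :=
  \sum_(s : 'S_m) (-1) ^+ s * \prod_a gen (row (s a) E).

Let gen0 : gen 0 = 0.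
Proof.
have := gen_linear (-1) 0 0; rewrite scaler0 addr0 rmorphN1 mulN1r addNr.
by [].
Qed.

Lemma gen_sum (I : Type) (r : seq I) (k : I -> K) (v : I -> 'rV_m) :
  gen (\sum_(i <- r) k i *: v i) = \sum_(i <- r) c (k i) * gen (v i).
Proof.
elim: r => [|i r IH]; first by rewrite !big_nil.
by rewrite !big_cons gen_linear IH.
Qed.

Lemma prod_scaled (I : Type) (r : seq I) (k : I -> K) (x : I -> B) :
  \prod_(i <- r) (c (k i) * x i) = c (\prod_(i <- r) k i) * \prod_(i <- r) x i.
Proof.
elim: r => [|i r IH]; first by rewrite !big_nil rmorph1 mulr1.
rewrite !big_cons IH rmorphM -!mulrA; congr (_ * _).
by rewrite !mulrA [c _ * x i]c_central.
Qed.

(** The argument is that of multiplicativity of determinants, and it needs no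
    commutation between the vectors: expanding the rows of [F *m E] gives a
    sum over all maps [f] of words in the rows of [E], the coefficient of each
    word being the determinant of the columns [f a] of [F]. *)
Lemma volume_mul F E : volume (F *m E) = c (\det F) * volume E.
Proof.
pose G (f : {ffun 'I_m -> 'I_m}) := \prod_a gen (row (f a) E).
transitivity (\sum_(f : {ffun 'I_m -> 'I_m})
    c (\det (\matrix_(a, i) F i (f a))) * G f).
  rewrite /volume; transitivity (\sum_(s : 'S_m) \sum_(f : {ffun 'I_m -> 'I_m})
     c ((-1) ^+ s * \prod_a F (s a) (f a)) * G f).
    apply: eq_bigr => s _; under eq_bigr => a _.
      rewrite (_ : gen _ = \sum_b c (F (s a) b) * gen (row b E)); last first.
        rewrite -gen_sum row_mul mulmx_sum_row; congr gen.
        by apply: eq_bigr => b _; rewrite mxE.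
      over.
    rewrite bigA_distr_bigA mulr_sumr; apply: eq_bigr => f _.
    by rewrite prod_scaled mulrA rmorphM rmorph_sign.
  rewrite exchange_big; apply: eq_bigr => f _; rewrite -mulr_suml -rmorph_sum.
  congr (c _ * _); apply: eq_bigr => s _; congr (_ * _).
  by apply: eq_bigr => a _; rewrite mxE.
rewrite (bigID (fun f : {ffun 'I_m -> 'I_m} => injectiveb f)) /=.
rewrite [X in _ + X]big1 ?addr0 => [|f /injectivePn[i1 [i2 i12 fi]]]; last first.
  rewrite (determinant_alternate i12) ?rmorph0 ?mul0r // => j.
  by rewrite !mxE fi.
rewrite (reindex (@pval _)) /=; last first.
  pose in_Sn := insubd (1%g : 'S_m).
  by exists in_Sn => /= f Uf; first apply: val_inj; apply: insubdK.
rewrite /volume mulr_sumr.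
apply: eq_big => /= [s | s _]; rewrite ?(valP s) //.
have -> : \matrix_(a, i) F i (pval s a) = row_perm s F^T.
  by apply/matrixP => a i; rewrite !mxE pvalE.
rewrite row_permE det_mulmx det_perm det_tr mulrC rmorphM -mulrA rmorph_sign.
by congr (_ * (_ * _)); apply: eq_bigr => a _; rewrite pvalE.
Qed.
End Volume.

Section Anticommuting.
Variable (B : pzRingType).

(** Moving the factor [f j] to its place crosses the [j] factors before it. *)
Lemma anticomm_prod_insert m (f : 'I_m.+1 -> B) j :
  (forall a b, a != b -> f a * f b = - (f b * f a)) ->
  f j * \prod_a f (lift j a) = (-1) ^+ j * \prod_a f a.
Proof.
elim: m f j => [|m IH] f j fA.
  by rewrite big_ord0 big_ord1 (ord1 j) mulr1 expr0 mul1r.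
case: (unliftP ord0 j) => [j'|] ->; last first.
  by rewrite expr0 mul1r [RHS]big_ord_recl.
rewrite [X in _ * X]big_ord_recl mulrA fA; last by rewrite -val_eqE.
have -> : lift (lift ord0 j') ord0 = ord0 by apply: val_inj.
have E : \prod_(a < m) f (lift (lift ord0 j') (lift ord0 a)) =
    \prod_(a < m) f (lift ord0 (lift j' a)).
  apply: eq_bigr => a _; congr f.
  by apply: val_inj; rewrite /= /bump /= !add1n ltnS; case: leqP.
rewrite mulNr -mulrA E.
rewrite (IH (fun a => f (lift ord0 a))); last first.
  by move=> a b ab; apply: fA; rewrite (inj_eq lift_inj).
rewrite [in RHS]big_ord_recl mulrA /= /bump /= add1n exprS mulN1r mulNr -!mulrA.
congr (- _); rewrite !mulrA; congr (_ * _).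
exact: commr_sign.
Qed.

(** By recursion on the first factor, the sign of a permutation of
    anticommuting factors follows the rule of [odd_lift_perm]. *)
Lemma anticomm_prod_perm m (f : 'I_m -> B) (s : 'S_m) :
  (forall a b, a != b -> f a * f b = - (f b * f a)) ->
  \prod_a f (s a) = (-1) ^+ s * \prod_a f a.
Proof.
elim: m f s => [|m IH] f s fA.
  have -> : s = 1%g by apply/permP; case.
  by rewrite odd_perm1 mul1r; apply: eq_bigr => a _; rewrite perm1.
pose u k := odflt k (unlift (s ord0) (s (lift ord0 k))).
have uK k : lift (s ord0) (u k) = s (lift ord0 k).
  rewrite /u; have := neq_lift ord0 k.
  by rewrite -(can_eq (permK s)) => /unlift_some[] ? ? ->.
have u_inj : injective u.
  by move=> k l ukl; apply: (@lift_inj _ ord0); apply: (@perm_inj _ s); rewrite -!uK ukl.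
pose t := perm u_inj.
have st : s = lift_perm ord0 (s ord0) t.
  apply/permP => k; case: (unliftP ord0 k) => [k'|] ->; rewrite ?lift_perm_id //.
  by rewrite lift_perm_lift permE uK.
have E : \prod_(a < m) f (s (lift ord0 a)) = \prod_(a < m) f (lift (s ord0) (t a)).
  by apply: eq_bigr => a _; rewrite permE uK.
rewrite [in LHS]big_ord_recl E (IH (fun a => f (lift (s ord0) a))); last first.
  by move=> a b ab; apply: fA; rewrite (inj_eq lift_inj).
rewrite [in (-1) ^+ s]st odd_lift_perm /= signr_addb.
rewrite mulrA [f _ * _]commr_sign -mulrA anticomm_prod_insert // mulrA.
by rewrite signr_odd; congr (_ * _); exact: commr_sign.
Qed.

Lemma anticomm_prod m (f : 'I_m -> B) (x : B) :
  (forall i, x * f i = - (f i * x)) ->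
  x * \prod_i f i = (-1) ^+ m * (\prod_i f i * x).
Proof.
elim: m f => [|m IH] f xf; first by rewrite !big_ord0 mulr1 !mul1r.
rewrite !big_ord_recl mulrA xf mulNr -mulrA IH // exprS mulN1r mulNr.
by congr (- _); rewrite !mulrA commr_sign.
Qed.

(** The factor [f j] commutes with itself and anticommutes with the [m - 1]
    others. *)
Lemma anticomm_prod_comm m (f : 'I_m -> B) (j : 'I_m) :
  (forall a b, a != b -> f a * f b = - (f b * f a)) ->
  f j * \prod_a f a = (-1) ^+ m.-1 * (\prod_a f a * f j).
Proof.
case: m f j => [|m] f j fA; first by case: j.
have := anticomm_prod_insert j fA; set Q := \prod_a f (lift j a).
set P := \prod_a f a => fQ.
have fjQ : f j * Q = (-1) ^+ m * (Q * f j).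
  rewrite /Q anticomm_prod //.
  by move=> a; apply: fA; rewrite neq_lift.
have PE : P = (-1) ^+ j * (f j * Q) by rewrite fQ mulrA -expr2 sqrr_sign mul1r.
have sC n x : x * (-1) ^+ n = (-1) ^+ n * x :> B by exact: commr_sign.
rewrite PE /= mulrA sC -mulrA {1}fjQ !mulrA.
by rewrite [X in X * _ * _ = _]sC !mulrA.
Qed.

(** Bringing the second copy of the first factor next to the first copy
    crosses the [m] remaining factors; the exponents add up to a binomial
    coefficient. *)
Lemma anticomm_prod_sqr (K : comPzRingType) (c : {rmorphism K -> B}) m
    (f : 'I_m -> B) (d : 'I_m -> K) :
  (forall k b, c k * b = b * c k) ->
  (forall a b, a != b -> f a * f b = - (f b * f a)) ->
  (forall a, f a * f a = c (d a)) ->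
  (\prod_a f a) * (\prod_a f a) = (-1) ^+ 'C(m, 2) * c (\prod_a d a).
Proof.
move=> cC; elim: m f d => [|m IH] f d fA fd.
  by rewrite !big_ord0 rmorph1 !mulr1.
rewrite !big_ord_recl; set P := \prod_(a < m) _.
have fP : P * f ord0 = (-1) ^+ m * (f ord0 * P).
  rewrite /P anticomm_prod //.
    by rewrite mulrA -expr2 sqrr_sign mul1r.
  by move=> a; apply: fA; rewrite neq_lift.
have sC n x : x * (-1) ^+ n = (-1) ^+ n * x :> B by exact: commr_sign.
rewrite -mulrA [P * _]mulrA fP -mulrA mulrA sC -!mulrA.
rewrite [P * P](IH _ (fun a => d (lift ord0 a))); last 2 first.
- by move=> a b ab; apply: fA; rewrite (inj_eq lift_inj).
- by move=> a; apply: fd.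
rewrite binS bin1 exprD rmorphM -fd [_ ^+ 'C(_, _) * _ ^+ _]sC -!mulrA.
by congr (_ * _); rewrite [f _ * ((-1) ^+ _ * _)]mulrA sC -!mulrA [LHS]mulrA sC -!mulrA.
Qed.

End Anticommuting.

Section QuadraticVolume.
Variables (K : fieldType) (m : nat) (B : pzRingType) (c : {rmorphism K -> B}).
Variables (gen : 'rV[K]_m -> B) (g : 'M[K]_m).
Hypothesis two_neq0 : 2%:R != 0 :> K.
Hypothesis g_sym : g^T = g.
Hypothesis c_central : forall k b, c k * b = b * c k.
Hypothesis gen_linear : forall k v w, gen (k *: v + w) = c k * gen v + gen w.
Hypothesis gen_sqr : forall v, gen v * gen v = c ((v *m g *m v^T) 0 0).

Let genD v w : gen (v + w) = gen v + gen w.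
Proof. by rewrite -[v]scale1r gen_linear rmorph1 mul1r scale1r. Qed.

(** Polarisation of the Clifford relation. *)
Lemma gen_orthogonal v w : (v *m g *m w^T) 0 0 = 0 ->
  gen v * gen w = - (gen w * gen v).
Proof.
move=> vw.
have wv : (w *m g *m v^T) 0 0 = 0.
  by rewrite -vw -[w *m g *m _]trmxK [in LHS]mxE !trmx_mul trmxK g_sym mulmxA.
have := gen_sqr (v + w); rewrite genD mulrDl !mulrDr !gen_sqr.
rewrite linearD /= !mulmxDl !mulmxDr !mxE.
move: vw wv; rewrite !mxE => -> ->; rewrite addr0 add0r rmorphD.
rewrite -addrA => /addrI; rewrite -[RHS]add0r addrA => /addIr /eqP.
by rewrite addr_eq0 => /eqP.
Qed.

Let volM F E : volume gen (F *m E) = c (\det F) * volume gen E.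
Proof. exact: volume_mul. Qed.

Let basis := sym_diagonalizable two_neq0 g_sym.

Lemma volume_orthogonal (F : 'M[K]_m) : is_diag_mx (F *m g *m F^T) ->
  [/\ forall a b, a != b ->
        gen (row a F) * gen (row b F) = - (gen (row b F) * gen (row a F)),
      forall a, gen (row a F) * gen (row a F) = c ((F *m g *m F^T) a a) &
      volume gen F = m`!%:R * \prod_a gen (row a F)].
Proof.
move=> Fd.
have E a b : (row a F *m g *m (row b F)^T) 0 0 = (F *m g *m F^T) a b.
  by rewrite tr_row colE mulmxA -!row_mul -colE [LHS]mxE [LHS]mxE.
have fA a b : a != b -> gen (row a F) * gen (row b F) = - (gen (row b F) * gen (row a F)).
  by move=> ab; apply: gen_orthogonal; rewrite E; move/is_diag_mxP : Fd; apply.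
split=> // [a|]; first by rewrite gen_sqr E.
transitivity (\sum_(s in {: 'S_m}) \prod_a gen (row a F)); last first.
  rewrite sumr_const mulr_natl; congr (_ *+ _).
  by rewrite -card_Sn; apply: eq_card => s; rewrite !inE.
apply: eq_big => [s|s _]; first by rewrite inE.
rewrite (anticomm_prod_perm (f := fun a => gen (row a F)) s) //.
by rewrite mulrA -expr2 sqrr_sign mul1r.
Qed.

(** Both sides being linear in [v] and proportional to [\det E], it is enough
    to check the rows of one orthogonal basis. *)
Lemma volume_anticomm (E : 'M[K]_m) (v : 'rV[K]_m) :
  gen v * volume gen E = (-1) ^+ m.-1 * (volume gen E * gen v).
Proof.
have [F Fu Fd] := basis; have [fA _ volF] := volume_orthogonal Fd.
have sC n x : x * (-1) ^+ n = (-1) ^+ n * x :> B by exact: commr_sign.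
have nC (n : nat) x : x * n%:R = n%:R * x :> B by exact: commr_nat.
set P := \prod_a _ in volF.
have vP : gen v * P = (-1) ^+ m.-1 * (P * gen v).
  rewrite -[v](mulmxKV Fu) mulmx_sum_row (gen_sum gen_linear) mulr_suml !mulr_sumr.
  apply: eq_bigr => a _; rewrite -mulrA (anticomm_prod_comm a fA) -/P.
  by rewrite [LHS]mulrA sC -!mulrA; congr (_ * _); rewrite mulrA c_central -mulrA.
rewrite -[E](mulmxKV Fu) volM volF mulrA -c_central -mulrA.
rewrite [gen v * _]mulrA nC -mulrA vP [_%:R * (_ ^+ _ * _)]mulrA sC !mulrA.
by rewrite c_central.
Qed.

(** The square of the volume element of a frame whose Gram matrix has
    determinant 1. *)
Definition volume_cst : K := (-1) ^+ 'C(m, 2) * (m`!%:R) ^+ 2.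

Lemma volume_sqr (E : 'M[K]_m) :
  volume gen E * volume gen E = c (volume_cst * \det (E *m g *m E^T)).
Proof.
have [F Fu Fd] := basis; have [fA fF volF] := volume_orthogonal Fd.
have sC n x : x * (-1) ^+ n = (-1) ^+ n * x :> B by exact: commr_sign.
have nC (n : nat) x : x * n%:R = n%:R * x :> B by exact: commr_nat.
have volFF : volume gen F * volume gen F = c (volume_cst * \det (F *m g *m F^T)).
  rewrite volF -mulrA [_ * (_ * \prod_a _)]mulrA nC -mulrA mulrA.
  rewrite (anticomm_prod_sqr c_central fA fF) /volume_cst.
  rewrite det_trig ?is_diag_mx_is_trig // !rmorphM !rmorphXn rmorphN1 rmorph_nat.
  by rewrite [LHS]mulrA sC.
rewrite -[E](mulmxKV Fu) volM; move: (_ *m invmx F) => H.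
rewrite -mulrA [volume _ _ * (_ * _)]mulrA -c_central -mulrA mulrA volFF.
rewrite -!rmorphM; congr (c _).
have -> : H *m F *m g *m (H *m F)^T = H *m (F *m g *m F^T) *m H^T.
  by rewrite trmx_mul !mulmxA.
by rewrite !det_mulmx !det_tr; ring.
Qed.

End QuadraticVolume.

(** * Calculus of functions of class C^k *)

Lemma near_eq_diff (R : numFieldType) (V W : normedModType R) (f g : V -> W) x :
  (\near x, f x = g x) -> differentiable f x ->
  differentiable g x /\ 'd g x = 'd f x :> (V -> W).
Proof.
move=> fg df.
have [dfc dfE] := (diff_locallyP x f).1 df.
have gE : g \o shift x = cst (g x) + 'd f x +o_ 0 id.
  have fgx := nbhs_singleton fg; rewrite /= in fgx.
  move: dfE; rewrite fgx => dfE.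
  apply/eqaddoP => e e0; move/eqaddoP: dfE => /(_ e e0) dfE.
  have fg0 : \forall h \near (0 : V), f (h + x) = g (h + x).
    by move/nbhs0P : fg; apply: filterS => h; rewrite addrC.
  by apply: filterS2 fg0 dfE => h /=; rewrite !fctE /= => ->.
have gd : 'd g x = 'd f x :> (V -> W) by apply: diff_unique.
by split=> //; apply/diff_locallyP; rewrite gd.
Qed.

Section SmoothCalculus.
Variables (R : realType) (m : nat).
Implicit Types (U W : set 'rV[R]_m) (f g : 'rV[R]_m -> R).

Lemma Ck_sub k U W f : W `<=` U -> Ck k U f -> Ck k W f.
Proof.
move=> WU; elim: k f => [|k IH] f /=; first by move=> fU x /WU; exact: fU.
by move=> [fd fk]; split=> [x /WU|v]; [exact: fd|exact/IH/fk].
Qed.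

(** [Ck k U] is the conjunction over the points of [U] of conditions on the
    germ of the function, so it can be checked on any cover of [U], open or
    not. *)
Lemma Ck_local k U f :
  (forall x, U x -> exists2 W, W x & Ck k W f) -> Ck k U f.
Proof.
elim: k f => [|k IH] f /= UW; first by move=> x /UW[W Wx]; apply.
split=> [x /UW[W Wx [fd _]]|v]; first exact: fd.
by apply: IH => x /UW[W Wx [_ fk]]; exists W.
Qed.

Lemma Ck_prev k U f : Ck k.+1 U f -> Ck k U f.
Proof.
elim: k f => [|k IH] f [fd fk].
  by move=> x Ux; exact/differentiable_continuous/fd.
by split=> // v; exact/IH/fk.
Qed.

Lemma Ck_eq k U f g : open U -> {in U, f =1 g} -> Ck k U f -> Ck k U g.
Proof.
move=> Uo; elim: k f g => [|k IH] f g fg.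
  move=> fU x Ux.
  have fgx : \near x, f x = g x.
    by apply: filterS (open_nbhs_nbhs (conj Uo Ux)) => y Uy; exact/fg/mem_set.
  rewrite /prop_for /continuous_at -(nbhs_singleton fgx).
  exact: cvg_trans (near_eq_cvg fgx) (fU x Ux).
have near_fg x : U x -> \near x, f x = g x.
  by move=> Ux; apply: filterS (open_nbhs_nbhs (conj Uo Ux)) => y Uy; exact/fg/mem_set.
move=> [fd fk]; split=> [x Ux|v].
  by have [] := near_eq_diff (near_fg x Ux) (fd x Ux).
by apply: IH (fk v) => x /set_mem Ux; exact/near_eq_derive/near_fg.
Qed.

Lemma Ck_cst k U a : Ck k U (fun=> a).
Proof.
elim: k a => [|k IH] a; first by move=> x _; exact: cst_continuous.
split=> [x _|v]; first exact: differentiable_cst.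
rewrite (_ : 'D_v _ = fun=> 0); first exact: IH.
by apply/funext => x; exact: derive_cst.
Qed.

Lemma CkD k U f g : open U -> Ck k U f -> Ck k U g -> Ck k U (fun x => f x + g x).
Proof.
move=> Uo; elim: k f g => [|k IH] f g.
  by move=> fU gU x Ux; apply: (@continuousD _ _ _ f g); [exact: fU|exact: gU].
move=> [fd fk] [gd gk]; split=> [x Ux|v].
  by apply: (@differentiableD _ _ _ f g); [exact: fd|exact: gd].
apply: Ck_eq (IH _ _ (fk v) (gk v)) => // x /set_mem Ux.
by rewrite -deriveD //; apply: diff_derivable; [exact: fd|exact: gd].
Qed.

Lemma CkM k U f g : open U -> Ck k U f -> Ck k U g -> Ck k U (fun x => f x * g x).
Proof.
move=> Uo; elim: k f g => [|k IH] f g.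
  by move=> fU gU x Ux; apply: (@continuousM _ _ f g); [exact: fU|exact: gU].
move=> fk1 gk1; have [[fd fk] [gd gk]] := (fk1, gk1); split=> [x Ux|v].
  by apply: (@differentiableM _ _ f g); [exact: fd|exact: gd].
apply: Ck_eq (CkD Uo (IH _ _ (Ck_prev fk1) (gk v)) (IH _ _ (Ck_prev gk1) (fk v))) => //.
move=> x /set_mem Ux /=.
by rewrite [RHS]deriveM //; apply: diff_derivable; [exact: fd|exact: gd].
Qed.

(** The derivative of an inverse is a product of inverses and of a derivative,
    so induction on [k] closes. *)
Lemma CkV k U f : open U -> (forall x, U x -> f x != 0) ->
  Ck k U f -> Ck k U (fun x => (f x)^-1).
Proof.
move=> Uo f0; elim: k => [|k IH].
  by move=> fU x Ux; apply: continuousV; [exact: f0|exact: fU].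
move=> fk1; have [fd fk] := fk1; split=> [x Ux|v].
  by apply: differentiableV; [exact: fd|exact: f0].
have fVk := IH (Ck_prev fk1).
apply: Ck_eq (CkM Uo (Ck_cst _ _ (-1)) (CkM Uo (CkM Uo fVk fVk) (fk v))) => //.
move=> x /set_mem Ux /=.
rewrite [RHS]deriveV ?f0 //; last exact/diff_derivable/fd.
by rewrite /GRing.scale /= mulN1r -invfM -expr2 mulNr.
Qed.

(** As for inverses: the derivative of the square root of [f] is that of [f]
    divided by twice the square root. *)
Lemma Ck_sqrtV k U f : open U -> (forall x, U x -> 0 < f x) ->
  Ck k U f -> Ck k U (fun x => (Num.sqrt (f x))^-1).
Proof.
move=> Uo f0 fk; apply: CkV => //; first by move=> x Ux; rewrite sqrtr_eq0 -ltNge f0.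
elim: k fk => [|k IH].
  by move=> fU x Ux; apply: continuous_comp; [exact: fU|exact: sqrt_continuous].
move=> fk1; have [fd fk] := fk1.
have dsq x : U x -> differentiable (Num.sqrt : R -> R) (f x).
  by move=> Ux; apply/derivable1_diffP; have [] := is_derive1_sqrt (f0 _ Ux).
have sqrt0 x : U x -> 2 * Num.sqrt (f x) != 0.
  by move=> Ux; rewrite mulf_neq0 ?pnatr_eq0 // sqrtr_eq0 -ltNge f0.
split=> [x Ux|v]; first exact/differentiable_comp/dsq/Ux/fd.
have sk := CkM Uo (Ck_cst k _ 2) (IH (Ck_prev fk1)).
apply: Ck_eq (CkM Uo (fk v) (CkV Uo sqrt0 sk)) => // x /set_mem Ux /=.
rewrite [RHS]deriveE; last exact/differentiable_comp/dsq/Ux/fd.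
rewrite diff_comp; [|exact: fd|exact: dsq].
have sqrt1 : 'd (Num.sqrt : R -> R) (f x) 1 = (2 * Num.sqrt (f x))^-1.
  by rewrite -deriveE ?derive_sqrt ?f0 //; exact: dsq.
rewrite /= deriveE; last exact: fd.
by rewrite -sqrt1 -[in RHS](mulr1 ('d f x v)) [RHS]linearZ.
Qed.

Lemma Ck_sum k U (I : Type) (r : seq I) (f : I -> 'rV[R]_m -> R) : open U ->
  (forall i, Ck k U (f i)) -> Ck k U (fun x => \sum_(i <- r) f i x).
Proof.
move=> Uo fk; elim: r => [|i r IH].
  by under eq_fun do rewrite big_nil; exact: Ck_cst.
by under eq_fun do rewrite big_cons; exact: CkD.
Qed.

Lemma Ck_prod k U (I : Type) (r : seq I) (f : I -> 'rV[R]_m -> R) : open U ->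
  (forall i, Ck k U (f i)) -> Ck k U (fun x => \prod_(i <- r) f i x).
Proof.
move=> Uo fk; elim: r => [|i r IH].
  by under eq_fun do rewrite big_nil; exact: Ck_cst.
by under eq_fun do rewrite big_cons; exact: CkM.
Qed.

Lemma Ck_det k U n (h : 'rV[R]_m -> 'M[R]_n) : open U ->
  (forall a b, Ck k U (fun x => h x a b)) -> Ck k U (fun x => \det (h x)).
Proof.
move=> Uo hk; rewrite /determinant.
apply: Ck_sum => // s; apply: CkM => //; first exact: Ck_cst.
by apply: Ck_prod => // i; exact: hk.
Qed.

Lemma differentiable_rowP (V : normedModType R) p (F : V -> 'rV[R]_p) x :
  (forall a, differentiable (fun y => F y 0 a : R) x) -> differentiable F x.
Proof.
move=> Fd; have -> : F = \sum_(a < p) (fun y => F y 0 a *: (delta_mx 0 a : 'rV[R]_p)).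
  apply/funext => y; rewrite fct_sumE; apply/rowP => b; rewrite summxE (bigD1 b) //=.
  rewrite big1 ?addr0 => [|a ab]; first by rewrite !mxE !eqxx mulr1.
  by rewrite !mxE [b == a]eq_sym (negPf ab) andbF mulr0.
by apply: differentiable_sum => a; exact: differentiableZl.
Qed.

Lemma mulmxr_linear_continuous p (A : 'M[R]_(m, p)) :
  continuous (mulmxr A : 'rV[R]_m -> 'rV[R]_p).
Proof.
move=> y; apply: differentiable_continuous; apply: differentiable_rowP => a.
have -> : (fun y : 'rV[R]_m => mulmxr A y 0 a) =
    \sum_(i < m) (fun y : 'rV[R]_m => y 0 i *: (A i a : R)).
  by apply/funext => z; rewrite fct_sumE mxE.
by apply: differentiable_sum => i; apply: differentiableZl; exact: differentiable_coord.
Qed.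

Lemma mulmxr_differentiable p (A : 'M[R]_(m, p)) (y : 'rV[R]_m) :
  differentiable (mulmxr A : 'rV[R]_m -> 'rV[R]_p) y.
Proof. exact/linear_differentiable/mulmxr_linear_continuous. Qed.

Lemma mulmxr_diff p (A : 'M[R]_(m, p)) (y : 'rV[R]_m) :
  'd (mulmxr A : 'rV[R]_m -> 'rV[R]_p) y = mulmxr A :> ('rV[R]_m -> 'rV[R]_p).
Proof. exact/diff_lin/mulmxr_linear_continuous. Qed.

(** The derivative of the composite along [v] is the derivative of [f] along
    [v *m A], composed with the same linear map. *)
Lemma Ck_mulmx k U W f (A : 'M[R]_m) : open W -> (forall y, W y -> U (y *m A)) ->
  Ck k U f -> Ck k W (fun y => f (y *m A)).
Proof.
move=> Wo WU; elim: k f => [|k IH] f.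
  move=> fU y Wy; apply: (@continuous_comp _ _ _ (mulmxr A)); last exact/fU/WU.
  by apply: differentiable_continuous; exact: mulmxr_differentiable.
move=> [fd fk].
have cd y : W y -> differentiable (fun y => f (y *m A)) y.
  move=> Wy; apply: (@differentiable_comp _ _ _ _ (mulmxr A) f); last exact/fd/WU.
  exact: mulmxr_differentiable.
split=> // v.
apply: Ck_eq (IH _ (fk (v *m A))) => // y /set_mem Wy.
rewrite [RHS]deriveE; last exact: cd.
rewrite (@diff_comp _ _ _ _ (mulmxr A) f); last 2 first.
- exact: mulmxr_differentiable.
- exact/fd/WU.
rewrite /= deriveE; last exact/fd/WU.
by rewrite mulmxr_diff.
Qed.

End SmoothCalculus.

(** * Calculus of smooth functions and matrices on a manifold *)

Section ChartTopology.
Variables (R : realType) (m : nat) (M : topologicalType) (c : chart R m M).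

Lemma param_in y (U : set M) : (coord c @` (dom c `&` U)) y ->
  dom c (param c y) /\ U (param c y) /\ coord c (param c y) = y.
Proof. by move=> [x [xd xU] <-]; rewrite coordK. Qed.

Lemma chart_img_open (U : set M) : open U -> open (coord c @` (dom c `&` U)).
Proof.
move=> Uo.
rewrite (_ : _ @` _ = (coord c @` dom c) `&` (param c @^-1` U)); last first.
  apply/seteqP; split=> [y [x [xd xU] <-]|y [[x xd <-]] /=].
    by split; [exists x|rewrite /= coordK].
  by rewrite coordK // => xU; exists x.
rewrite openE => y [yc yU].
have yco : nbhs y (coord c @` dom c) by apply: open_nbhs_nbhs; split=> //; exact: img_open.
apply: filterI => //; apply: (param_continuous yc); exact: open_nbhs_nbhs.
Qed.

Lemma dom_near (x : M) : dom c x -> \forall z \near x, dom c z.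
Proof. by move=> xd; apply: open_nbhs_nbhs; split=> //; exact: dom_open. Qed.

End ChartTopology.

Section ManifoldCalculus.
Variables (R : realType) (m : nat) (M : manifold R m).
Implicit Types (U W : set M) (f g : M -> R).

Lemma msmooth_local U f :
  (forall x, U x -> exists2 W, W x & msmooth W f) -> msmooth U f.
Proof.
move=> UW i k; apply: Ck_local => y [x [xd xU] <-].
have [W Wx fW] := UW x xU.
by exists (coord (atlas i) @` (dom (atlas i) `&` W)); [exists x|exact: fW].
Qed.

Lemma msmooth_sub U W f : W `<=` U -> msmooth U f -> msmooth W f.
Proof. by move=> WU fU; apply: msmooth_local => x /WU xU; exists U. Qed.

Lemma msmooth_eq U f g : open U -> (forall x, U x -> f x = g x) ->
  msmooth U f -> msmooth U g.
Proof.
move=> Uo fg fU i k; apply: Ck_eq (fU i k); first exact: chart_img_open.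
by move=> y /set_mem/param_in[_ [yU _]]; exact: fg.
Qed.

Lemma msmooth_cst U a : msmooth U (fun=> a).
Proof. by move=> i k; exact: Ck_cst. Qed.

Lemma msmoothD U f g : open U -> msmooth U f -> msmooth U g ->
  msmooth U (fun x => f x + g x).
Proof.
move=> Uo fU gU i k.
exact: (CkD (chart_img_open Uo) (fU i k) (gU i k)).
Qed.

Lemma msmoothM U f g : open U -> msmooth U f -> msmooth U g ->
  msmooth U (fun x => f x * g x).
Proof.
move=> Uo fU gU i k.
exact: (CkM (chart_img_open Uo) (fU i k) (gU i k)).
Qed.

Lemma msmoothN U f : open U -> msmooth U f -> msmooth U (fun x => - f x).
Proof.
move=> Uo fU; under eq_fun do rewrite -mulN1r.
by apply: msmoothM => //; exact: msmooth_cst.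
Qed.

Lemma msmoothV U f : open U -> (forall x, U x -> f x != 0) ->
  msmooth U f -> msmooth U (fun x => (f x)^-1).
Proof.
move=> Uo f0 fU i k; apply: (CkV (chart_img_open Uo) _ (fU i k)).
by move=> y /param_in[_ [/f0]].
Qed.

Lemma msmooth_sqrtV U f : open U -> (forall x, U x -> 0 < f x) ->
  msmooth U f -> msmooth U (fun x => (Num.sqrt (f x))^-1).
Proof.
move=> Uo f0 fU i k; apply: (Ck_sqrtV (chart_img_open Uo) _ (fU i k)).
by move=> y /param_in[_ [/f0]].
Qed.

Lemma msmooth_continuous U f x : open U -> msmooth U f -> U x ->
  {for x, continuous f}.
Proof.
move=> Uo fU xU; pose c := chart_at x; have xd : dom c x := chart_idx_atP x.
have cont := fU (chart_idx_at x) 0%N.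
have : {for x, continuous (f \o param c \o coord c)}.
  apply: continuous_comp; first exact: coord_continuous.
  by apply: cont; exists x.
have ff : \near x, (f \o param c \o coord c) x = f x.
  by apply: filterS (dom_near xd) => z zd; rewrite /= coordK.
rewrite /prop_for /continuous_at -(nbhs_singleton ff) => H.
exact: cvg_trans (near_eq_cvg ff) H.
Qed.

Lemma msmooth_gt0_near U f x : open U -> msmooth U f -> U x -> 0 < f x ->
  \forall y \near x, 0 < f y.
Proof.
move=> Uo fU xU f0; exact: cvgr_gt (msmooth_continuous Uo fU xU) _ f0.
Qed.

Lemma msmooth_det U n (h : M -> 'M[R]_n) : open U ->
  (forall a b, msmooth U (fun x => h x a b)) -> msmooth U (fun x => \det (h x)).
Proof.
move=> Uo hU i k.
by apply: (Ck_det (chart_img_open Uo)) => a b; exact: (hU a b i k).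
Qed.

(** Smoothness of a complex function, in the form in which it occurs in
    [cmsmooth]. *)
Definition csmooth U (f : M -> R[i]) :=
  msmooth U (fun x => complex.Re (f x)) /\ msmooth U (fun x => complex.Im (f x)).

Implicit Types (u v : M -> R[i]).

Lemma csmooth_sub U W u : W `<=` U -> csmooth U u -> csmooth W u.
Proof. by move=> WU [ur ui]; split; exact: msmooth_sub WU _. Qed.

Lemma csmooth_eq U u v : open U -> (forall x, U x -> u x = v x) ->
  csmooth U u -> csmooth U v.
Proof.
by move=> Uo uv [ur ui]; split; [apply: msmooth_eq ur|apply: msmooth_eq ui] => //
  x /uv ->.
Qed.

Lemma csmooth_cst U a : csmooth U (fun=> a).
Proof. by split; exact: msmooth_cst. Qed.

Lemma csmooth_real U f : msmooth U f -> csmooth U (fun x => (f x)%:C%C).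
Proof. by move=> fU; split=> //=; exact: msmooth_cst. Qed.

Lemma csmoothD U u v : open U -> csmooth U u -> csmooth U v ->
  csmooth U (fun x => u x + v x).
Proof.
move=> Uo [ur ui] [vr vi]; split.
  by apply: msmooth_eq (msmoothD Uo ur vr) => // x _; case: (u x) (v x) => ? ? [].
by apply: msmooth_eq (msmoothD Uo ui vi) => // x _; case: (u x) (v x) => ? ? [].
Qed.

Lemma csmoothM U u v : open U -> csmooth U u -> csmooth U v ->
  csmooth U (fun x => u x * v x).
Proof.
move=> Uo [ur ui] [vr vi]; split.
  apply: msmooth_eq (msmoothD Uo (msmoothM Uo ur vr)
    (msmoothN Uo (msmoothM Uo ui vi))) => // x _.
  by case: (u x) (v x) => ? ? [].
apply: msmooth_eq (msmoothD Uo (msmoothM Uo ur vi) (msmoothM Uo ui vr)) => // x _.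
by case: (u x) (v x) => ? ? [].
Qed.

Lemma csmooth_conj U u : open U -> csmooth U u -> csmooth U (fun x => conjc (u x)).
Proof.
move=> Uo [ur ui]; split.
  by apply: msmooth_eq ur => // x _; case: (u x).
by apply: msmooth_eq (msmoothN Uo ui) => // x _; case: (u x).
Qed.

Lemma csmoothV U u : open U -> (forall x, U x -> u x != 0) ->
  csmooth U u -> csmooth U (fun x => (u x)^-1).
Proof.
move=> Uo u0 us; have [ur ui] := us.
pose n x := complex.Re (u x) * complex.Re (u x) + complex.Im (u x) * complex.Im (u x).
have n0 x : U x -> n x != 0.
  move=> /u0; rewrite /n; case: (u x) => a b; apply: contraNneq => /=.
  rewrite -!expr2 => /eqP; rewrite paddr_eq0 ?sqr_ge0 // !sqrf_eq0.
  by move=> /andP[/eqP-> /eqP->].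
have nV : msmooth U (fun x => (n x)^-1).
  by apply: msmoothV => //; apply: msmoothD => //; exact: msmoothM.
apply: csmooth_eq (csmoothM Uo (csmooth_real nV) (csmooth_conj Uo us)) => // x Ux.
apply: (mulIf (u0 x Ux)); rewrite mulVf ?u0 //; move: (n0 x Ux); rewrite /n.
case: (u x) => a b /= nx; rewrite -mulrA; apply/eqP; rewrite eq_complex /=.
by rewrite !mul0r; apply/andP; split; apply/eqP; field.
Qed.

Lemma csmooth_sum U (I : Type) (r : seq I) (u : I -> M -> R[i]) : open U ->
  (forall i, csmooth U (u i)) -> csmooth U (fun x => \sum_(i <- r) u i x).
Proof.
move=> Uo us; elim: r => [|i r IH].
  by under eq_fun do rewrite big_nil; exact: csmooth_cst.
by under eq_fun do rewrite big_cons; exact: csmoothD.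
Qed.

Lemma csmooth_prod U (I : Type) (r : seq I) (u : I -> M -> R[i]) : open U ->
  (forall i, csmooth U (u i)) -> csmooth U (fun x => \prod_(i <- r) u i x).
Proof.
move=> Uo us; elim: r => [|i r IH].
  by under eq_fun do rewrite big_nil; exact: csmooth_cst.
by under eq_fun do rewrite big_cons; exact: csmoothM.
Qed.

Lemma csmooth_neq0_near U u x : open U -> csmooth U u -> U x -> u x != 0 ->
  \forall y \near x, u y != 0.
Proof.
move=> Uo [ur ui] Ux u0.
have nU : msmooth U (fun x => complex.Re (u x) * complex.Re (u x) +
    complex.Im (u x) * complex.Im (u x)).
  by apply: msmoothD => //; exact: msmoothM.
have nE (z : R[i]) : (z != 0) =
    (0 < complex.Re z * complex.Re z + complex.Im z * complex.Im z).
  case: z => a b /=; rewrite eq_complex /= -!expr2.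
  rewrite lt0r addr_ge0 ?sqr_ge0 // andbT paddr_eq0 ?sqr_ge0 //.
  by rewrite !sqrf_eq0.
rewrite nE in u0; apply: filterS (msmooth_gt0_near Uo nU Ux u0) => y.
by rewrite -nE.
Qed.

Lemma cmsmooth_sub U W p n (h : M -> 'M[R[i]]_(p, n)) :
  W `<=` U -> cmsmooth U h -> cmsmooth W h.
Proof. by move=> WU hU a b; exact: csmooth_sub WU (hU a b). Qed.

Lemma cmsmooth_eq U p n (h k : M -> 'M[R[i]]_(p, n)) : open U ->
  (forall x, U x -> h x = k x) -> cmsmooth U h -> cmsmooth U k.
Proof.
move=> Uo hk hU a b; apply: (csmooth_eq Uo _ (hU a b)) => x Ux.
by rewrite hk.
Qed.

Lemma cmsmooth_cst U p n (A : 'M[R[i]]_(p, n)) : cmsmooth U (fun=> A).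
Proof. by move=> a b; exact: csmooth_cst. Qed.

Lemma cmsmoothD U p n (h k : M -> 'M[R[i]]_(p, n)) : open U ->
  cmsmooth U h -> cmsmooth U k -> cmsmooth U (fun x => h x + k x).
Proof.
move=> Uo hU kU a b; apply: csmooth_eq (csmoothD Uo (hU a b) (kU a b)) => //.
by move=> x _; rewrite mxE.
Qed.

Lemma cmsmooth_sum U p n (I : Type) (r : seq I) (h : I -> M -> 'M[R[i]]_(p, n)) :
  open U -> (forall i, cmsmooth U (h i)) -> cmsmooth U (fun x => \sum_(i <- r) h i x).
Proof.
move=> Uo hU; elim: r => [|i r IH].
  by under eq_fun do rewrite big_nil; exact: cmsmooth_cst.
by under eq_fun do rewrite big_cons; exact: cmsmoothD.
Qed.

Lemma cmsmoothZ U p n u (h : M -> 'M[R[i]]_(p, n)) : open U ->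
  csmooth U u -> cmsmooth U h -> cmsmooth U (fun x => u x *: h x).
Proof.
move=> Uo uU hU a b; apply: csmooth_eq (csmoothM Uo uU (hU a b)) => //.
by move=> x _; rewrite mxE.
Qed.

Lemma cmsmoothM U p n q (h : M -> 'M[R[i]]_(p, n)) (k : M -> 'M[R[i]]_(n, q)) :
  open U -> cmsmooth U h -> cmsmooth U k -> cmsmooth U (fun x => h x *m k x).
Proof.
move=> Uo hU kU a b.
apply: csmooth_eq (csmooth_sum (index_enum 'I_n) Uo
  (fun j => csmoothM Uo (hU a j) (kU j b))) => //.
by move=> x _; rewrite mxE.
Qed.

Lemma cmsmooth_adj U p n (h : M -> 'M[R[i]]_(p, n)) : open U ->
  cmsmooth U h -> cmsmooth U (fun x => (map_mx conjc (h x))^T).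
Proof.
move=> Uo hU a b; apply: csmooth_eq (csmooth_conj Uo (hU b a)) => //.
by move=> x _; rewrite !mxE.
Qed.

Lemma csmooth_det U n (h : M -> 'M[R[i]]_n) : open U ->
  cmsmooth U h -> csmooth U (fun x => \det (h x)).
Proof.
move=> Uo hU; rewrite /determinant.
apply: csmooth_sum => // s; apply: csmoothM => //; first exact: csmooth_cst.
by apply: csmooth_prod => // i; exact: hU.
Qed.

(** Cramer's rule. *)
Lemma cmsmoothV U n (h : M -> 'M[R[i]]_n) : open U ->
  (forall x, U x -> h x \in unitmx) ->
  cmsmooth U h -> cmsmooth U (fun x => invmx (h x)).
Proof.
move=> Uo hu hU.
have dU := csmooth_det Uo hU.
have d0 x : U x -> \det (h x) != 0 by move=> /hu; rewrite unitmxE unitfE.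
apply: (@cmsmooth_eq _ _ _ (fun x => (\det (h x))^-1 *: \adj (h x))) => //.
  by move=> x Ux; rewrite /invmx hu.
apply: cmsmoothZ => //; first exact: csmoothV.
move=> a b; apply: (csmooth_eq Uo (u := fun x => cofactor (h x) b a)).
  by move=> x _; rewrite mxE.
rewrite /cofactor; apply: csmoothM => //; first exact: csmooth_cst.
apply: csmooth_det => // i j; apply: csmooth_eq (hU _ _) => // x _.
by rewrite !mxE.
Qed.

End ManifoldCalculus.

(** * Linear maps, eigenvectors, and the volume element of the Clifford algebra *)

Section LinearFunctions.
Variables (K : comNzRingType).

Definition lin_of (U V : lmodType K) (f : U -> V) (lf : linear f) :
  {linear U -> V} := HB.pack f (GRing.isLinear.Build K U V *:%R f lf).

Lemma linear_fun0 (U V : lmodType K) (f : U -> V) : linear f -> f 0 = 0.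
Proof. by move=> lf; exact: (raddf0 (lin_of lf)). Qed.

Lemma linear_funD (U V : lmodType K) (f : U -> V) : linear f ->
  {morph f : u v / u + v}.
Proof. by move=> lf; exact: (raddfD (lin_of lf)). Qed.

Lemma linear_funN (U V : lmodType K) (f : U -> V) : linear f ->
  {morph f : u / - u}.
Proof. by move=> lf; exact: (raddfN (lin_of lf)). Qed.

Lemma linear_funZ (U V : lmodType K) (f : U -> V) : linear f ->
  forall k u, f (k *: u) = k *: f u.
Proof. by move=> lf; exact: (linearZ_LR (lin_of lf)). Qed.

Lemma linear_col n p (f : 'cV[K]_n -> 'cV[K]_p) : linear f ->
  exists A : 'M[K]_(p, n), forall u, f u = A *m u.
Proof.
move=> lf; exists (\matrix_(i, j) f (delta_mx j 0) i 0) => u.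
have -> : f u = \sum_j u j 0 *: f (delta_mx j 0).
  rewrite [in LHS](matrix_sum_delta u) -[f]/(lin_of lf : _ -> _) linear_sum.
  by apply: eq_bigr => j _; rewrite big_ord1 linearZ.
apply/colP => i; rewrite summxE mxE; apply: eq_bigr => j _.
by rewrite !mxE mulrC.
Qed.

Lemma linear_inverse (U V : lmodType K) (f : U -> V) (g : V -> U) :
  linear f -> cancel f g -> cancel g f -> linear g.
Proof.
by move=> lf fK gK k u v; apply: (can_inj fK); rewrite lf !gK.
Qed.

End LinearFunctions.

Section Eigen.
Variable (C : closedFieldType).

Lemma eigenvector_exists r (F : lmodType C) (e : 'cV[C]_r -> F) (L : F -> F) :
  (0 < r)%N -> linear e -> bijective e -> linear L ->
  exists lam u, u <> 0 /\ L u = lam *: u.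
Proof.
move=> r0 le [d eK dK] lL.
have ld := linear_inverse le eK dK.
have [A AE] : exists A : 'M[C]_r, forall u, d (L (e u)) = A *m u.
  by apply: (@linear_col _ _ _ (fun u => d (L (e u)))) => k u v; rewrite le lL ld.
have [|lam] := closed_rootP (char_poly A^T) _.
  by rewrite size_char_poly; case: r r0 {e d L le eK dK lL ld A AE}.
rewrite -eigenvalue_root_char => /eigenvalueP[v vA v0].
exists lam, (e v^T); split.
  move=> ev0; move/eqP: v0; apply; apply: trmx_inj; apply: (can_inj eK).
  by rewrite ev0 trmx0 linear_fun0.
apply: (can_inj dK); rewrite AE (linear_funZ ld) eK.
by rewrite -[A]trmxK -trmx_mul vA linearZ.
Qed.
End Eigen.

Section Subspaces.
Variables (R : realType) (F : lmodType R[i]).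
Implicit Types W : set F.

Lemma subspace_opp W u : subspace W -> W u -> W (- u).
Proof. by move=> [W0 WP] Wu; rewrite -scaleN1r -[_ *: _]addr0; exact: WP. Qed.
Lemma subspaceD W u v : subspace W -> W u -> W v -> W (u + v).
Proof. by move=> [W0 WP] Wu; rewrite -[u]scale1r; exact: WP. Qed.
Lemma subspaceZ W k u : subspace W -> W u -> W (k *: u).
Proof. by move=> [W0 WP] Wu; rewrite -[_ *: _]addr0; exact: WP. Qed.

End Subspaces.

Lemma half_double (K : numFieldType) (V : lmodType K) (u : V) :
  2^-1 *: (u + u) = u.
Proof.
have -> : u + u = (2 : K) *: u by rewrite scaler_nat mulr2n.
by rewrite scalerA mulVf ?scale1r ?pnatr_eq0.
Qed.

(** Such a [z] is real or imaginary, so that one of the two parts is zero and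
    the other one is not. *)
Lemma sqr_real_Re_Im (R : rcfType) (z : R[i]) (a : R) : z ^+ 2 = a%:C%C -> a != 0 ->
  complex.Re z + complex.Im z != 0.
Proof.
case: z => b c; rewrite expr2 => -[/= ba bc] a0.
apply: contra a0 => /eqP bc0; have {bc0} cE : c = - b by rewrite -(addKr b c) bc0 addr0.
by apply/eqP; rewrite -ba cE; ring.
Qed.

Section CliffordVolume.
Variables (R : realType) (m : nat) (G : 'M[R]_m) (q : 'rV[R]_m -> R).
Hypothesis qE : forall v, q v = (v *m G *m v^T) 0 0.
Hypothesis G_sym : G^T = G.
Hypothesis G_unit : G \in unitmx.

Lemma cl_cst_central k (b : Cl q) : cl_cst q k * b = b * cl_cst q k.
Proof. by rewrite -cl_scaleE cl_cstE -cl_scaleAr mulr1. Qed.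

Let gl k v w : cl_gen q (k *: v + w) = cl_cst q k * cl_gen q v + cl_gen q w.
Proof. exact: cl_gen_linear. Qed.

Let gs v : cl_gen q v * cl_gen q v = cl_cst q ((v *m G *m v^T) 0 0).
Proof. by rewrite cl_gen_sqr -qE cl_cstE. Qed.

Let two0 : 2%:R != 0 :> R. Proof. by rewrite pnatr_eq0. Qed.

Definition clvol (E : 'M[R]_m) : Cl q := volume (cl_gen q) E.

Lemma clvol_mul F E : clvol (F *m E) = \det F *: clvol E.
Proof. by rewrite cl_scaleE -(volume_mul cl_cst_central gl). Qed.

Lemma clvol_anticomm E v :
  cl_gen q v * clvol E = (-1) ^+ m.-1 * (clvol E * cl_gen q v).
Proof. exact: (volume_anticomm two0 G_sym cl_cst_central gl gs). Qed.

Lemma clvol_sqr E :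
  clvol E * clvol E = (volume_cst R m * \det (E *m G *m E^T)) *: (1 : Cl q).
Proof. by rewrite -cl_cstE -(volume_sqr two0 G_sym cl_cst_central gl gs). Qed.

Lemma cl_even0 : cl_even (0 : Cl q).
Proof. by rewrite -(scale0r (1 : Cl q)); exact: cl_even_cst. Qed.

Lemma cl_even_sign n : cl_even ((-1) ^+ n : Cl q).
Proof.
have -> : (-1) ^+ n = ((-1) ^+ n : R) *: (1 : Cl q).
  by rewrite -cl_cstE rmorphXn rmorphN1.
exact: cl_even_cst.
Qed.

(** The words of [volume] have length [m]. *)
Lemma clvol_even E : ~~ odd m -> cl_even (clvol E).
Proof.
move=> mo; rewrite /clvol /volume.
apply: (big_ind (@cl_even _ _ q)); [exact: cl_even0|exact: cl_evenD|move=> s _].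
apply: cl_evenM; first exact: cl_even_sign.
have ev n (f : 'I_n.*2 -> 'rV[R]_m) : cl_even (\prod_a cl_gen q (f a)).
  elim: n f => [|n IH] f.
    by rewrite big_ord0 -(scale1r (1 : Cl q)); exact: cl_even_cst.
  change (cl_even (\prod_(a < n.*2.+2) cl_gen q (f a))).
  rewrite !big_ord_recl mulrA; apply: cl_evenM; first exact: cl_even_gen.
  exact: IH (fun i => f (lift ord0 (lift ord0 i))).
have {}ev n (f : 'I_n -> 'rV[R]_m) : ~~ odd n -> cl_even (\prod_a cl_gen q (f a)).
  by move=> no; move: f; rewrite -(even_halfK no) => f; exact: ev.
exact: ev.
Qed.

(** The automorphism replaces the frame [E] by [- E], whose determinant is
    that of [E] up to the sign (-1)^m. *)
Lemma cl_alpha_vol E : odd m -> cl_alpha (clvol E) = - clvol E.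
Proof.
move=> mo; have [a1 aZ aD aM ag] := cl_alphaP q.
have aprod (f : 'I_m -> 'rV[R]_m) (r : seq 'I_m) :
    cl_alpha (\prod_(i <- r) cl_gen q (f i)) = \prod_(i <- r) cl_gen q (- f i).
  by elim: r => [|i r IH]; rewrite ?big_nil // !big_cons aM ag IH linearN.
have asgn n x : cl_alpha ((-1) ^+ n * x) = (-1) ^+ n * cl_alpha x :> Cl q.
  have -> y : (-1) ^+ n * y = ((-1) ^+ n : R) *: y :> Cl q.
    by rewrite cl_scaleE rmorphXn rmorphN1.
  by rewrite aZ cl_scaleE rmorphXn rmorphN1.
have -> : cl_alpha (clvol E) = clvol (- E).
  rewrite /clvol /volume; rewrite (big_morph (@cl_alpha _ _ q) aD (id1 := 0)); last first.
    by rewrite -(scale0r (1 : Cl q)) aZ !scale0r.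
  apply: eq_bigr => s _; rewrite asgn aprod; congr (_ * _).
  by apply: eq_bigr => i _; congr cl_gen; apply/rowP => j; rewrite !mxE.
have -> : - E = (-1)%:M *m E by rewrite mul_scalar_mx scaleN1r.
by rewrite clvol_mul det_scalar -signr_odd mo scaleN1r.
Qed.

(** Crossing a vector costs (-1)^(m - 1): nothing for odd [m], and for even
    [m] nothing after crossing two vectors. *)
Lemma clvol_comm E a : (if odd m then setT else @cl_even _ _ q) a ->
  clvol E * a = a * clvol E.
Proof.
have sC n x : x * (-1) ^+ n = (-1) ^+ n * x :> Cl q by exact: commr_sign.
case: ifP => mo.
  move=> _; elim/cl_ind: a => [k|v|a b ca cb|a b ca cb].
  - by rewrite -cl_cstE cl_cst_central.
  - by rewrite clvol_anticomm -signr_odd -subn1 oddB ?odd_gt0 // mo mul1r.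
  - by rewrite mulrDl mulrDr ca cb.
  - by rewrite mulrA ca -mulrA cb mulrA.
elim=> [k|v w|a' b _ ca _ cb|a' b _ ca _ cb].
- by rewrite -cl_cstE cl_cst_central.
- rewrite -[RHS]mulrA clvol_anticomm [RHS]mulrA sC -[RHS]mulrA.
  rewrite [cl_gen q v * (_ * _)]mulrA clvol_anticomm -!mulrA [RHS]mulrA.
  by rewrite -expr2 sqrr_sign mul1r.
- by rewrite mulrDl mulrDr ca cb.
- by rewrite mulrA ca -mulrA cb mulrA.
Qed.

Lemma anisotropic_exists : (0 < m)%N -> exists v, q v != 0.
Proof.
move=> m0; apply: contrapT => /forallNP q0.
have G0 : G = 0.
  apply: (sym_isotropic_eq0 two0 G_sym) => v; apply/matrixP => i j.
  by rewrite !ord1 -qE mxE; apply/eqP/negPn/negP; exact: q0.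
have /matrixP/(_ (Ordinal m0) (Ordinal m0)) := mulmxV G_unit.
by rewrite {1}G0 mul0mx !mxE eqxx => /eqP; rewrite eq_sym oner_eq0.
Qed.

End CliffordVolume.

(** * The operator that exchanges the two eigenspaces of the volume element *)

Section Chirality.
Variables (R : realType) (m : nat) (q : 'rV[R]_m -> R).

(** Convertible to [Cld], over one tangent space. *)
Definition clifford_d : set (Cl q) := if odd m then setT else @cl_even _ _ q.

(** The part of the structure of the Dirac and Cartan representations that the
    equivalence uses, in a form common to both parities. [T] exchanges the two
    eigenspaces of [w], and irreducibility holds for [clifford_d] together
    with [T], though not for [clifford_d] alone. *)
Definition chirality_swap (F : lmodType R[i]) (w : Cl q) (rho : Cl q -> F -> F)
    (T : F -> F) :=
  [/\ linear T, (exists2 k, k != 0 & forall u, T (T u) = k *: u),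
     forall a, clifford_d a -> exists2 a', clifford_d a' &
       forall u, rho a (T u) = T (rho a' u),
     forall u, T (rho w u) = - rho w (T u) &
     forall W : set F, subspace W ->
       (forall a u, clifford_d a -> W u -> W (rho a u)) ->
       (forall u, W u -> W (T u)) -> W = [set 0] \/ W = setT].

Lemma chirality_swap_equiv (E F : lmodType R[i]) w
    (rho : Cl q -> E -> E) (sigma : Cl q -> F -> F) T :
  equivalent rho sigma -> chirality_swap w rho T ->
  exists T', chirality_swap w sigma T'.
Proof.
move=> [J [lJ [I JK IK] Jrho]] [lT [k k0 TT] Trho Tw Tirr].
have lI := linear_inverse lJ JK IK.
have Irho a u : I (sigma a u) = rho a (I u).
  by apply: (can_inj JK); rewrite IK Jrho IK.
exists (J \o T \o I); split.
- by move=> c u v /=; rewrite lI lT lJ.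
- by exists k => // u /=; rewrite JK TT (linear_funZ lJ) IK.
- move=> a /Trho[a' Sa' aT]; exists a' => // u /=.
  by rewrite -Jrho aT Irho.
- by move=> u /=; rewrite Irho Tw (linear_funN lJ) Jrho.
- move=> W Wsub Wrho WT.
  have [|||WE|WE] := Tirr [set u | W (J u)].
  + have [W0 WP] := Wsub; split=> [|c u v /= Wu Wv].
      by rewrite /= (linear_fun0 lJ).
    by rewrite lJ; exact: WP.
  + by move=> a u Sa /= Wu; rewrite Jrho; exact: Wrho.
  + by move=> u /= Wu; have := WT _ Wu; rewrite /= JK.
  + left; apply/seteqP; split=> [u Wu|_ ->]; last by case: Wsub.
    have : [set u | W (J u)] (I u) by rewrite /= IK.
    by rewrite WE /= => Iu0; rewrite -[u]IK Iu0 /= (linear_fun0 lJ).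
  + right; apply/seteqP; split=> // u _.
    have : [set u | W (J u)] (I u) by rewrite WE.
    by rewrite /= IK.
Qed.

Variable G : 'M[R]_m.
Hypothesis qE : forall v, q v = (v *m G *m v^T) 0 0.
Hypothesis G_sym : G^T = G.
Hypothesis G_unit : G \in unitmx.
Hypothesis m_gt0 : (0 < m)%N.

Let vol : Cl q := clvol q 1%:M.
Let vol_square : R := volume_cst R m * \det G.

Lemma vol_sqr : vol * vol = vol_square *: (1 : Cl q).
Proof. by rewrite /vol (clvol_sqr qE G_sym) mul1mx trmx1 mulmx1. Qed.

Lemma volume_cst_neq0 : volume_cst R m != 0.
Proof.
by rewrite mulf_neq0 ?expf_neq0 ?pnatr_eq0 ?oppr_eq0 ?oner_neq0 // -lt0n fact_gt0.
Qed.

Lemma vol_square_neq0 : vol_square != 0.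
Proof. by rewrite mulf_neq0 ?volume_cst_neq0 // -unitfE -unitmxE. Qed.

Lemma clifford_d_vol : clifford_d vol.
Proof.
by rewrite /clifford_d; case: ifPn => // mo; exact: clvol_even.
Qed.

Lemma vol_comm a : clifford_d a -> vol * a = a * vol.
Proof. exact: (clvol_comm qE G_sym). Qed.

Section DiracType.
Variables (F : lmodType R[i]) (delta : Cl q -> F -> F).
Hypothesis m_even : ~~ odd m.
Hypothesis delta_rep : is_rep setT delta.
Hypothesis delta_irr : irreducible setT delta.

Let dE : clifford_d = @cl_even _ _ q.
Proof. by rewrite /clifford_d (negPf m_even). Qed.

(** Conjugation by a non-isotropic vector preserves the even subalgebra. *)
Lemma even_twist v a : q v != 0 -> cl_even a ->
  exists2 a', cl_even a' & a * cl_gen q v = cl_gen q v * a'.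
Proof.
move=> qv; elim=> [k|x y|a1 b1 _ [a' ea' aE] _ [b' eb' bE]
  |a1 b1 _ [a' ea' aE] _ [b' eb' bE]].
- exists (k *: (1 : Cl q)); first exact: cl_even_cst.
  by rewrite -cl_cstE cl_cst_central.
- exists (((q v)^-1 *: (1 : Cl q)) * ((cl_gen q v * cl_gen q x) * (cl_gen q y * cl_gen q v))).
    apply: cl_evenM; first exact: cl_even_cst.
    by apply: cl_evenM; exact: cl_even_gen.
  rewrite -cl_cstE [RHS]mulrA -cl_cst_central -[RHS]mulrA [cl_gen q v * (_ * _)]mulrA.
  rewrite [cl_gen q v * (_ * _)]mulrA cl_gen_sqr -cl_cstE !mulrA -rmorphM mulVf //.
  by rewrite rmorph1 mul1r.
- by exists (a' + b'); [exact: cl_evenD|rewrite mulrDl mulrDr aE bE].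
- exists (a' * b'); first exact: cl_evenM.
  by rewrite -mulrA bE mulrA aE -mulrA.
Qed.

(** Here [T] is the product by a non-isotropic vector [v]. Any vector [x] is
    [v] times an even element, namely [v * x] divided by [q v], so a subspace
    stable under [T] and the even subalgebra is stable under the whole
    Clifford algebra. *)
Lemma Dirac_chirality_swap : exists T, chirality_swap vol delta T.
Proof.
have [v qv] := anisotropic_exists qE G_sym G_unit m_gt0.
have [dl dD dZ dM d1] := delta_rep.
exists (delta (cl_gen q v)); split.
- exact: dl.
- exists (q v)%:C%C => [|u]; first by rewrite (inj_eq (@complexI _) _ 0).
  by rewrite -dM // cl_gen_sqr dZ // d1.
- rewrite dE => a ea; have [a' ea' aE] := even_twist qv ea.
  by exists a' => // u; rewrite -!dM // aE.
- move=> u; rewrite -!dM // (clvol_anticomm qE G_sym) -signr_odd.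
  have -> : odd m.-1 by rewrite -subn1 oddB // (negPf m_even).
  rewrite mulN1r -[- _]scaleN1r dZ //.
  by rewrite rmorphN1 scaleN1r.
- rewrite dE => W Wsub We Wv; apply: delta_irr.2 => // a u _.
  elim/cl_ind: a u => [k|x|a b Wa Wb|a b Wa Wb] u Wu.
  + by rewrite dZ // d1; exact: subspaceZ.
  + have -> : cl_gen q x =
        cl_gen q v * (((q v)^-1 *: (1 : Cl q)) * (cl_gen q v * cl_gen q x)).
      rewrite -cl_cstE [RHS]mulrA -cl_cst_central -[RHS]mulrA [cl_gen q v * (_ * _)]mulrA.
      by rewrite cl_gen_sqr -cl_cstE !mulrA -rmorphM mulVf // rmorph1 mul1r.
    rewrite dM //; apply: Wv; apply: We => //.
    by apply: cl_evenM; [exact: cl_even_cst|exact: cl_even_gen].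
  + by rewrite dD //; apply: subspaceD; [|exact: Wa|exact: Wb].
  + by rewrite dM //; apply: Wa; exact: Wb.
Qed.
End DiracType.

Section CartanType.
Variables (r : nat) (sigma : Cl q -> 'cV[R[i]]_r -> 'cV[R[i]]_r).
Hypothesis r_gt0 : (0 < r)%N.
Hypothesis m_odd : odd m.
Hypothesis sigma_rep : is_rep setT sigma.
Hypothesis sigma_irr : irreducible (@cl_even _ _ q) sigma.

Let dE : clifford_d = setT.
Proof. by rewrite /clifford_d m_odd. Qed.

(** Schur's lemma: an eigenspace of the central element [vol] is stable, hence
    everything. *)
Lemma sigma_vol_scalar : exists2 lam, lam != 0 & forall u, sigma vol u = lam *: u.
Proof.
have [sl sD sZ sM s1] := sigma_rep.
have [lam [u [u0 lu]]] := eigenvector_exists (e := id) r_gt0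
  (fun _ _ _ => erefl) (Bijective (fun=> erefl) (fun=> erefl)) (sl vol I).
have sub : subspace [set u | sigma vol u = lam *: u].
  split=> [|k x y /= xl yl]; first by rewrite /= (linear_fun0 (sl vol I)) scaler0.
  by rewrite sl // xl yl scalerDr !scalerA mulrC.
have [a x ea /= xl|W0|WT] := sigma_irr.2 _ sub.
- by rewrite -sM // vol_comm ?dE // sM // xl (linear_funZ (sl a I)).
- by have : [set u | sigma vol u = lam *: u] u by []; rewrite W0.
exists lam => [|x]; last by have : [set u | sigma vol u = lam *: u] x by rewrite WT.
apply: contra_notN u0 => /eqP lam0; rewrite lam0 scale0r in lu.
have := sM vol vol I I u; rewrite lu (linear_fun0 (sl vol I)) vol_sqr sZ // s1.
by move/eqP; rewrite scaler_eq0 (inj_eq (@complexI _) _ 0) (negPf vol_square_neq0) => /eqP.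
Qed.

(** Here [T] exchanges the two copies. The volume element acts by opposite
    scalars on them, so a stable subspace contains the two components of each
    of its vectors and is the sum of a subspace of each copy; stability under
    the exchange makes both the same subspace, to which irreducibility
    applies. *)
Lemma Cartan_chirality_swap : exists T, chirality_swap vol (Cartan_sum sigma) T.
Proof.
have [sl sD sZ sM s1] := sigma_rep.
have [lam lam0 sv] := sigma_vol_scalar.
have [a1 aZ aD aM ag] := cl_alphaP q.
have aK (a : Cl q) : cl_alpha (cl_alpha a) = a.
  elim/cl_ind: a => [k|v|a b aa bb|a b aa bb].
  - by rewrite !aZ !a1.
  - by rewrite ag -scaleN1r aZ ag scaleN1r opprK.
  - by rewrite !aD aa bb.
  - by rewrite !aM aa bb.
have sva u : sigma (cl_alpha vol) u = - (lam *: u).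
  rewrite cl_alpha_vol // -[- vol]scaleN1r sZ // rmorphN1 scaleN1r.
  by rewrite sv.
exists (fun u => (u.2, u.1)); split.
- by move=> k u v.
- by exists 1 => [|[u1 u2]]; rewrite ?oner_neq0 ?scale1r.
- move=> a _; exists (cl_alpha a); first by rewrite dE.
  by move=> u; rewrite /Cartan_sum /= aK.
- move=> [u1 u2]; rewrite /Cartan_sum /= !sv !sva.
  by congr (_, _); rewrite /= opprK.
rewrite dE => W Wsub Wr WT.
pose W1 := [set u | W (u, 0)].
have W1sub : subspace W1.
  have [W0 WP] := Wsub; split=> // k x y; rewrite /W1 /= => Wx Wy.
  have := WP k _ _ Wx Wy; rewrite /W1 /=.
  by rewrite (_ : _ + _ = (k *: x + y, 0)) //; congr (_, _); rewrite /= scaler0 addr0.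
have Wsplit u : W u -> W (u.1, 0) /\ W (u.2, 0).
  move=> Wu; have Wfst v : W v -> W (v.1, 0).
    move=> Wv; have Wl := subspaceZ lam Wsub Wv.
    have := subspaceZ (lam^-1 / 2) Wsub (subspaceD Wsub Wl (Wr vol v I Wv)).
    rewrite /Cartan_sum sv sva (_ : _ *: _ = (v.1, 0)) //; congr (_, _).
      rewrite /= -scalerDl scalerA (_ : _ * _ = 1) ?scale1r //.
      have -> : lam + lam = lam * 2 by rewrite mulr_natr mulr2n.
      by rewrite mulrACA mulVf // mul1r mulVf ?pnatr_eq0.
    by rewrite /= addrN scaler0.
  by split; [exact: Wfst|have := Wfst _ (WT _ Wu)].
have Wcat u : W (u.1, 0) -> W (u.2, 0) -> W u.
  move=> W1u /WT/= W2u; have := subspaceD Wsub W1u W2u.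
  rewrite (_ : _ + _ = u) //; case: u {W1u W2u} => a b.
  by congr (_, _); rewrite /= ?addr0 ?add0r.
have [a u _ W1u|W1E|W1E] := sigma_irr.2 W1 W1sub.
- have := Wr a _ I W1u; rewrite /Cartan_sum /= (linear_fun0 (sl (cl_alpha a) I)).
  by [].
- left; apply/seteqP; split=> [u /Wsplit|_ ->]; last by case: Wsub.
  rewrite -![W (_, 0)]/(W1 _) W1E /= => -[].
  by case: u => a b /= -> ->.
- by right; apply/seteqP; split=> // u _; apply: Wcat; rewrite -[W _]/(W1 _) W1E.
Qed.
End CartanType.

End Chirality.

(** * Invariant summands and ranks of eigenspaces *)

Section Summand.
Variables (R : realType) (m : nat) (q : 'rV[R]_m -> R) (F : lmodType R[i]).
Variables (tau : Cl q -> F -> F) (T : F -> F) (vol : Cl q) (vol_square : R).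
Hypothesis tau_rep : is_rep setT tau.
Hypothesis T_swap : chirality_swap vol tau T.
Hypothesis vol_in : clifford_d vol.
Hypothesis vol_comm : forall a, clifford_d a -> vol * a = a * vol.
Hypothesis vol_sqr : vol * vol = vol_square *: (1 : Cl q).

Variables (r : nat) (e : 'cV[R[i]]_r -> F).
Hypothesis r_gt0 : (0 < r)%N.
Hypothesis e_lin : linear e.
Hypothesis e_inj : injective e.
Hypothesis e_inv : forall a u, clifford_d a -> exists u', tau a (e u) = e u'.
Hypothesis e_proper : exists x, forall u, x <> e u.

(** Let [P] be the range of [e], a proper subspace stable under [clifford_d].
    Then [P] meets its image under [T] trivially, because the intersection is
    stable under [clifford_d] and [T]. An eigenspace [W] of [vol] in [P] is
    stable under [clifford_d], and [W + T W] is also stable under [T], hence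
    everything. Writing a vector of [P] as [w + T w'] with [w, w'] in [W], the
    term [T w'] lies in [P], hence vanishes: so [W] is all of [P]. *)
Lemma volume_scalar_on_summand : exists2 lam : R[i],
  lam ^+ 2 = vol_square%:C%C & forall u, tau vol (e u) = lam *: e u.
Proof.
have [tl tD tZ tM t1] := tau_rep.
have [lT [k k0 TT] tT Tv Tirr] := T_swap.
have /choice[L LE] : forall u, exists u', tau vol (e u) = e u'.
  by move=> u; exact: e_inv.
have lL : linear L.
  by move=> c u v; apply: e_inj; rewrite -LE !e_lin (tl vol I) !LE.
have [lam [u0 [u00 Lu0]]] := eigenvector_exists (e := id) r_gt0
  (fun _ _ _ => erefl) (Bijective (fun=> erefl) (fun=> erefl)) lL.
pose P x := exists u, x = e u.
pose W x := P x /\ tau vol x = lam *: x.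
have Psub : subspace P.
  split=> [|c _ _ [u ->] [v ->]]; first by exists 0; rewrite (linear_fun0 e_lin).
  by exists (c *: u + v); rewrite e_lin.
have Wsub : subspace W.
  have [P0 PP] := Psub; split=> [|c x y [Px Wx] [Py Wy]].
    by split; rewrite // (linear_fun0 (tl vol I)) scaler0.
  split; first exact: PP.
  by rewrite (tl vol I) Wx Wy scalerDr !scalerA mulrC.
have Pinv a x : clifford_d a -> P x -> P (tau a x).
  by move=> Sa [u ->]; have [u' ->] := e_inv u Sa; exists u'.
have Winv a x : clifford_d a -> W x -> W (tau a x).
  move=> Sa [Px Wx]; split; first exact: Pinv.
  by rewrite -tM // vol_comm // tM // Wx (linear_funZ (tl a I)).
have We : W (e u0).
  by split; [exists u0|rewrite LE Lu0 (linear_funZ e_lin)].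
have e0 : e u0 <> 0.
  by move=> e0; apply: u00; apply: e_inj; rewrite e0 (linear_fun0 e_lin).
have PT0 x p : P x -> P p -> x = T p -> x = 0.
  move=> Px Pp xE.
  (* The intersection of [P] with its image under [T]. *)
  pose X := [set x | P x /\ exists2 p, P p & x = T p].
  have [|a y Sa [Py [p' Pp' yE]]|y [Py [p' Pp' yE]]|XE|XE] := Tirr X.
  - have [P0 PP] := Psub; split; first by split=> //; exists 0; rewrite ?(linear_fun0 lT).
    move=> c y z [Py [p1 Pp1 yE]] [Pz [p2 Pp2 zE]]; split; first exact: PP.
    by exists (c *: p1 + p2); [exact: PP|rewrite lT yE zE].
  - have [a' Sa' aT] := tT a Sa; split; first exact: Pinv.
    by exists (tau a' p'); [exact: Pinv|rewrite yE aT].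
  - split; last by exists y.
    by rewrite yE TT; exact: subspaceZ.
  - have : X x by split=> //; exists p.
    by rewrite XE.
  - have [z zP] := e_proper.
    have [[u zu] _] : X z by rewrite XE.
    by case: (zP u).
have WTall x : exists w w', [/\ W w, W w' & x = w + T w'].
  pose Y := [set x | exists w w', [/\ W w, W w' & x = w + T w']].
  have [W0 WP] := Wsub.
  have [|a y Sa [w [w' [Ww Ww' ->]]]|y [w [w' [Ww Ww' ->]]]|YE|YE] := Tirr Y.
  - split; first by exists 0, 0; split=> //; rewrite (linear_fun0 lT) addr0.
    move=> c _ _ [w1 [w1' [Ww1 Ww1' ->]]] [w2 [w2' [Ww2 Ww2' ->]]].
    exists (c *: w1 + w2), (c *: w1' + w2'); split; [exact: WP|exact: WP|].
    by rewrite lT scalerDr addrACA.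
  - have [a' Sa' aT] := tT a Sa.
    exists (tau a w), (tau a' w'); split; [exact: Winv|exact: Winv|].
    by rewrite (linear_funD (tl a I)) aT.
  - exists (k *: w'), w; split=> //; first exact: subspaceZ.
    by rewrite (linear_funD lT) TT addrC.
  - have : Y (e u0) by exists (e u0), 0; split=> //; rewrite (linear_fun0 lT) addr0.
    by rewrite YE.
  - by have : Y x by rewrite YE.
have PW x : P x -> W x.
  move=> Px; have [w [w' [Ww Ww' xE]]] := WTall x.
  suff /eqP : x - w = 0 by rewrite subr_eq0 => /eqP->.
  apply: (PT0 _ w'); [|exact: Ww'.1|by rewrite xE addrC addKr].
  by apply: subspaceD => //; apply: subspace_opp => //; exact: Ww.1.
exists lam => [|u]; last by have [] : W (e u) by apply: PW; exists u.
have := tM vol vol I I (e u0); rewrite vol_sqr tZ // t1.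
rewrite We.2 (linear_funZ (tl vol I)) We.2 scalerA => /eqP.
rewrite -subr_eq0 -scalerBl scaler_eq0 subr_eq0 expr2 => /orP[/eqP->//|/eqP].
by [].
Qed.
End Summand.

Section Rank.
Variable (K : fieldType).
Hypothesis two_neq0 : 2%:R != 0 :> K.

(** [B] conjugates [1 + A] to [1 - A]; these have the same rank, product 0,
    and an invertible sum. *)
Lemma involution_rank N (A B : 'M[K]_N) k : A *m A = 1%:M -> k != 0 ->
  B *m B = k%:M -> B *m A = - (A *m B) -> (\rank (1%:M + A)%R).*2 = N.
Proof.
move=> AA k0 BB BA.
have Bu : B \in unitmx.
  have : (k^-1 *: B) *m B = 1%:M by rewrite -scalemxAl BB scale_scalar_mx mulVf.
  by case/mulmx1_unit.
have rE : \rank (1%:M + A)%R = \rank (1%:M - A)%R.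
  have : B *m (1%:M + A) = (1%:M - A) *m B.
    by rewrite mulmxDr mulmxBl mulmx1 mul1mx BA.
  have fB : row_full B by rewrite row_full_unit.
  move/(congr1 mxrank); rewrite (eqmxMfull _ fB) => ->.
  by rewrite mxrankMfree ?row_free_unit.
apply/eqP; rewrite -addnn eqn_leq {2 3}rE; apply/andP; split.
  apply: mulmx0_rank_max.
  by rewrite mulmxDl !mulmxBr !mul1mx mulmx1 AA addrA subrK subrr.
apply: leq_trans (mxrank_add _ _).
rewrite addrACA addNr addr0 -mulr2n -scaler_nat scalemx1 mxrank_unit //.
by rewrite unitmxE det_scalar unitrX // unitfE.
Qed.
End Rank.

(** * Orientations as coherent signs *)

Section Transitions.
Variables (R : realType) (m : nat) (M : topologicalType).
Implicit Types c d e : chart R m M.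

Lemma differentiable_transition c d x : compatible c d -> dom c x -> dom d x ->
  differentiable (transition c d) (coord c x).
Proof.
move=> cd xc xd; apply: differentiable_rowP => a.
by have [+ _] := cd a 1%N; apply; exists x.
Qed.

Lemma param_near c x : dom c x -> forall P : M -> Prop,
  (\forall z \near x, P z) -> \forall y \near coord c x, P (param c y).
Proof.
move=> xc P xP; apply: (@param_continuous _ _ _ c (coord c x)); first by exists x.
by rewrite /= coordK.
Qed.

Lemma mx_row_inj p (A B : 'M[R]_(m, p)) : (forall u : 'rV_m, u *m A = u *m B) -> A = B.
Proof. by move=> AB; apply/row_matrixP => i; rewrite !rowE. Qed.

Lemma jacobianE p (f : 'rV[R]_m -> 'rV[R]_p) y u : u *m 'J f y = 'd f y u.
Proof. by rewrite mul_rV_lin1. Qed.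

Lemma chart_jacE c d x u :
  u *m chart_jac c d x = 'd (transition c d) (coord c x) u.
Proof. exact: jacobianE. Qed.

Let transition_chain c d e x : dom c x -> dom d x ->
  \forall y \near coord c x, (transition d e \o transition c d) y = transition c e y.
Proof.
move=> xc xd; have := param_near xc (dom_near xd); apply: filterS => y yd.
by rewrite /transition /= coordK.
Qed.

Let transition_at c d x : dom c x -> transition c d (coord c x) = coord d x.
Proof. by move=> xc; rewrite /transition /= coordK. Qed.

Lemma differentiable_transition_chain c d e x : dom c x -> dom d x ->
  differentiable (transition c d) (coord c x) ->
  differentiable (transition d e) (coord d x) ->
  differentiable (transition c e) (coord c x).
Proof.
move=> xc xd dcd; rewrite -(transition_at d xc) => dde.
have [dce _] := near_eq_diff (transition_chain e xc xd) (differentiable_comp dcd dde).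
exact: dce.
Qed.

(** The chain rule; in the convention of [chart_jac], where Jacobians act on
    the right of row vectors, it keeps the order of the charts. *)
Lemma chart_jac_chain c d e x : dom c x -> dom d x ->
  differentiable (transition c d) (coord c x) ->
  differentiable (transition d e) (coord d x) ->
  chart_jac c e x = chart_jac c d x *m chart_jac d e x.
Proof.
move=> xc xd dcd dde.
have dde' : differentiable (transition d e) (transition c d (coord c x)).
  by rewrite transition_at.
have [_ dE] := near_eq_diff (transition_chain e xc xd) (differentiable_comp dcd dde').
apply: mx_row_inj => u.
rewrite [RHS]mulmxA; apply: eq_trans (chart_jacE c e x u) _.
apply: eq_trans (esym (chart_jacE d e x (u *m chart_jac c d x))).
apply: eq_trans (congr1 (@^~ u) dE) _.
apply: eq_trans (congr1 (@^~ u) (diff_comp dcd dde')) _.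
rewrite /comp (transition_at d xc); exact: (congr1 _ (esym (chart_jacE c d x u))).
Qed.

Lemma differentiable_transition_id c x : dom c x ->
  differentiable (transition c c) (coord c x) /\ chart_jac c c x = 1%:M.
Proof.
move=> xc.
have near_eq : \forall y \near coord c x,
    (mulmxr 1%:M : 'rV[R]_m -> 'rV[R]_m) y = transition c c y.
  have yc : nbhs (coord c x) (coord c @` dom c).
    by apply: open_nbhs_nbhs; split; [exact: img_open|exists x].
  apply: filterS yc => _ [z zc <-].
  by rewrite /transition /= mulmx1 coordK.
have [dt dE] := near_eq_diff near_eq (mulmxr_differentiable _ _).
split; first exact: dt.
apply: mx_row_inj => u; apply: eq_trans (chart_jacE c c x u) _.
apply: eq_trans (congr1 (@^~ u) dE) _.
exact: (congr1 (@^~ u) (mulmxr_diff 1%:M (coord c x))).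
Qed.

Lemma chart_jacV c d x : compatible c d -> compatible d c -> dom c x -> dom d x ->
  chart_jac c d x *m chart_jac d c x = 1%:M.
Proof.
move=> cd dc xc xd; have [_ Jcc] := differentiable_transition_id xc.
apply: eq_trans Jcc; apply: esym.
by apply: (chart_jac_chain xc xd); exact: differentiable_transition.
Qed.

Lemma det_chart_jac_neq0 c d x : compatible c d -> compatible d c ->
  dom c x -> dom d x -> \det (chart_jac c d x) != 0.
Proof.
move=> cd dc xc xd; rewrite -unitfE -unitmxE.
have [Ju _] := mulmx1_unit (chart_jacV cd dc xc xd); exact: Ju.
Qed.

Lemma chart_jac_derive c d x a b : compatible c d -> dom c x -> dom d x ->
  chart_jac c d x a b = 'D_(delta_mx 0 a) (fun y => transition c d y 0 b) (coord c x).
Proof.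
move=> cd xc xd; have dt := differentiable_transition cd xc xd.
have -> : chart_jac c d x a b = ((delta_mx 0 a : 'rV[R]_m) *m chart_jac c d x) 0 b.
  by rewrite -rowE [RHS]mxE.
rewrite chart_jacE -deriveE //.
rewrite derive_mx ?mxE //; exact: diff_derivable.
Qed.

(** The entries of the Jacobian are partial derivatives of smooth functions of
    the coordinates. *)
Lemma det_chart_jac_continuous c d x : compatible c d -> dom c x -> dom d x ->
  {for x, continuous (fun y => \det (chart_jac c d y))}.
Proof.
move=> cd xc xd.
pose V := coord c @` (dom c `&` dom d).
pose J (y : 'rV[R]_m) : 'M[R]_m := \matrix_(a, b)
  'D_(delta_mx 0 a) (fun y => transition c d y 0 b) y.
have Jk : Ck 0 V (fun y => \det (J y)).
  have Vo : open V by apply: chart_img_open; exact: dom_open.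
  apply: Ck_det => // a b; have [_ dk] := cd b 1%N.
  pose f := 'D_(delta_mx 0 a) (fun y => transition c d y 0 b).
  have fk : Ck 0 V f by exact: dk.
  have fJ : {in V, f =1 (fun y => J y a b)} by move=> y _; rewrite mxE.
  exact: Ck_eq Vo fJ fk.
have near_eq : \forall y \near x, \det (J (coord c y)) = \det (chart_jac c d y).
  near=> y; congr (\det _); apply/matrixP => a b; rewrite mxE chart_jac_derive //.
    by near: y; exact: dom_near.
  by near: y; exact: dom_near.
have cJ : {for x, continuous (fun y => \det (J (coord c y)))}.
  have Vx : V (coord c x) by exists x.
  exact: (continuous_comp (coord_continuous xc) (Jk _ Vx)).
have E : \det (J (coord c x)) = \det (chart_jac c d x) := nbhs_singleton near_eq.
move: cJ; rewrite /prop_for /continuous_at E => cJ.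
exact: cvg_trans (near_eq_cvg near_eq) cJ.
Unshelve. all: by end_near. Qed.

End Transitions.

(* Comparing two Jacobians by unfolding them does not terminate in practice. *)
Opaque chart_jac.

Section Twist.
Variables (R : realType) (m : nat) (M : topologicalType) (c : chart R m M).
Variables (V : set M) (A : 'M[R]_m).
Hypothesis V_open : open V.
Hypothesis AA : A *m A = 1%:M.

Let cA : continuous (mulmxr A : 'rV[R]_m -> 'rV[R]_m).
Proof. exact: mulmxr_linear_continuous. Qed.

Let AK : involutive (mulmxr A : 'rV[R]_m -> 'rV[R]_m).
Proof. by move=> y /=; rewrite -mulmxA AA mulmx1. Qed.

Lemma twist_img (W : set M) : (fun x => coord c x *m A) @` W =
  (mulmxr A : 'rV[R]_m -> 'rV[R]_m) @^-1` (coord c @` W).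
Proof.
apply/seteqP; split=> [_ [x Wx <-]|y [x Wx xy]].
  by exists x => //; rewrite -[RHS]/(mulmxr A (mulmxr A (coord c x))) AK.
by exists x => //; rewrite xy; exact: AK.
Qed.

Let twist_dom_open : open (dom c `&` V).
Proof. by apply: openI => //; exact: dom_open. Qed.

Let twist_img_open : open ((fun x => coord c x *m A) @` (dom c `&` V)).
Proof.
rewrite twist_img; apply: open_comp; first by move=> y _; exact: cA.
exact: chart_img_open.
Qed.

Let twistK x : (dom c `&` V) x -> param c (coord c x *m A *m A) = x.
Proof. by move=> [xc _]; rewrite -mulmxA AA mulmx1 coordK. Qed.

Let twist_coord_continuous x : (dom c `&` V) x ->
  {for x, continuous (fun x => coord c x *m A)}.
Proof.
move=> [xc _].
exact: (@continuous_comp _ _ _ (coord c) (mulmxr A) x (coord_continuous xc) (@cA _)).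
Qed.

Let twist_param_continuous y : ((fun x => coord c x *m A) @` (dom c `&` V)) y ->
  {for y, continuous (fun y : 'rV[R]_m => param c (y *m A))}.
Proof.
rewrite twist_img => -[x [xc _] xy].
have pc : {for mulmxr A y, continuous (param c)}.
  by apply: param_continuous; exists x.
exact: (@continuous_comp _ _ _ (mulmxr A) (param c) y (@cA _) pc).
Qed.

(** Since [A] is an involution, it serves for both [coord] and [param]; the
    identity and reflections are enough for changing orientations. *)
Definition twist : chart R m M := Chart twist_dom_open twist_img_open twistK
  twist_coord_continuous twist_param_continuous.

Lemma twist_compatible_l d : compatible c d -> compatible twist d.
Proof.
move=> cd a k; apply: (Ck_mulmx _ _ (cd a k)).
  by apply: (chart_img_open (c := twist)); exact: dom_open.
move=> _ [x [[xc _] xd] <-]; exists x; first by [].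
by rewrite /= -mulmxA AA mulmx1.
Qed.

Lemma twist_compatible_r d : compatible d c -> compatible d twist.
Proof.
move=> dc a k.
have Wo : open (coord d @` (dom d `&` dom twist)).
  by apply: chart_img_open; exact: dom_open.
have sub : coord d @` (dom d `&` dom twist) `<=` coord d @` (dom d `&` dom c).
  by move=> _ [x [xd [xc _]] <-]; exists x.
have smooth_b b : Ck k (coord d @` (dom d `&` dom twist))
    (fun y => transition d c y 0 b * A b a).
  by apply: CkM => //; [exact: Ck_sub sub (dc b k)|exact: Ck_cst].
apply: (Ck_eq Wo _ (Ck_sum (index_enum 'I_m) Wo smooth_b)) => y _.
by rewrite [RHS]mxE.
Qed.

Lemma chart_jac_twist x : dom twist x ->
  differentiable (transition twist c) (coord twist x) /\ chart_jac twist c x = A.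
Proof.
move=> xt.
have near_eq : \forall y \near coord twist x,
    (mulmxr A : 'rV[R]_m -> 'rV[R]_m) y = transition twist c y.
  have yt : nbhs (coord twist x) (coord twist @` dom twist).
    by apply: open_nbhs_nbhs; split; [exact: img_open|exists x].
  apply: filterS yt => _ [z [zc zV] <-].
  by rewrite /transition /= -mulmxA AA mulmx1 coordK.
have [dt dE] := near_eq_diff near_eq (mulmxr_differentiable _ _).
split; first exact: dt.
apply: mx_row_inj => u; apply: eq_trans (chart_jacE twist c x u) _.
apply: eq_trans (congr1 (@^~ u) dE) _.
exact: (congr1 (@^~ u) (mulmxr_diff A (coord twist x))).
Qed.

Lemma det_chart_jac_twist d x : compatible c d -> dom twist x -> dom d x ->
  \det (chart_jac twist d x) = \det A * \det (chart_jac c d x).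
Proof.
move=> cd xt xd; have [dt JA] := chart_jac_twist xt.
have xc := xt.1.
rewrite -det_mulmx -{1}JA; congr (\det _).
by apply: (chart_jac_chain xt xc dt); exact: differentiable_transition.
Qed.

End Twist.

Section Orientation.
Variables (R : realType) (m : nat) (M : manifold R m).
Hypothesis m_gt0 : (0 < m)%N.

(** The determinant of the coordinate fields of the chart [i] with respect to
    the basis in which tangent vectors at [x] are written. It is not
    continuous in [x], since this basis is chosen independently at each point. *)
Definition frame_det (i : atlas_idx M) (x : M) : R :=
  \det (chart_jac (atlas i) (chart_at x) x).

Lemma frame_detE i x :
  frame_det i x = \det (chart_jac (atlas i) (chart_at x) x).
Proof. by []. Qed.

Lemma frame_det_neq0 i x : dom (atlas i) x -> frame_det i x != 0.
Proof.
move=> xi; apply: det_chart_jac_neq0 => //; try exact: atlas_compatible.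
exact: chart_idx_atP.
Qed.

(** [o x] stands for an orientation of the tangent space at [x], given by its
    sign on the basis in which tangent vectors at [x] are written. Only the
    sign of [o] matters, and [o] has no reason to be continuous; the condition
    is that the coordinate fields of each chart have a locally constant
    orientation. *)
Definition orientation_sign (o : M -> R) :=
  (forall x, o x != 0) /\
  forall i x, dom (atlas i) x ->
    \forall y \near x, 0 < (o x * frame_det i x) * (o y * frame_det i y).

(** Take for [o x] the Jacobian determinant from a chart of the oriented atlas
    around [x]. Near a given point it may be replaced, up to a positive
    factor, by the one of a single such chart, since those charts have
    positive Jacobians among themselves; what remains is a continuous function
    without zeros. *)
Lemma orientable_sign : orientable M -> exists o, orientation_sign o.
Proof.
move=> [J [c [cc cov pos]]].
have /choice[jx jxP] := cov.
have at_x (x : M) : dom (chart_at x) x by exact: chart_idx_atP.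
have ccl j i : compatible (c j) (atlas i) by have [] := cc j i.
have ccr j i : compatible (atlas i) (c j) by have [] := cc j i.
have [ o oE ] : exists o : M -> R, forall x,
  o x = \det (chart_jac (c (jx x)) (chart_at x) x).
  exact: ex_intro _ (fun x => \det (chart_jac (c (jx x)) (chart_at x) x)) (fun=> erefl).
have sg_neq0 x : o x != 0.
  rewrite oE; apply: det_chart_jac_neq0 => //; [exact: ccl|exact: ccr].
exists o; split; first exact: sg_neq0.
move=> i x xi.
pose j := jx x.
have [D DE0] : exists D : M -> R, forall y, D y = \det (chart_jac (atlas i) (c j) y).
  exact: ex_intro _ (fun y => \det (chart_jac (atlas i) (c j) y)) (fun=> erefl).
have DE (y : M) : dom (atlas i) y -> dom (c j) y ->
    exists2 k : R, 0 < k & o y * frame_det i y = k * D y.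
  move=> yi yj; pose l := jx y.
  have yl : dom (c l) y := jxP y.
  have ya := at_x y.
  have D1 : frame_det i y = D y * \det (chart_jac (c j) (chart_at y) y).
    rewrite /frame_det DE0 -det_mulmx; congr (\det _).
    apply: (chart_jac_chain yi yj).
      by apply: differentiable_transition => //; exact: ccr.
    by apply: differentiable_transition => //; exact: ccl.
  have D2 : \det (chart_jac (c j) (chart_at y) y) =
      \det (chart_jac (c j) (c l) y) * o y.
    rewrite oE -/l -det_mulmx; congr (\det _).
    apply: (chart_jac_chain yj yl); last first.
      by apply: differentiable_transition => //; exact: ccl.
    apply: (differentiable_transition_chain yj ya).
      by apply: differentiable_transition => //; exact: ccl.
    by apply: differentiable_transition => //; exact: ccr.
  exists (\det (chart_jac (c j) (c l) y) * (o y * o y)).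
    by rewrite mulr_gt0 ?pos // -expr2 exprn_even_gt0 // sg_neq0.
  have alg (f d e p a : R) : f = d * e -> e = p * a -> a * f = p * (a * a) * d.
    by move=> -> ->; ring.
  exact: alg D1 D2.
have xj : dom (c j) x := jxP x.
have [k k0 ->] := DE x xi xj.
have Dx0 : D x != 0 by rewrite DE0; apply: det_chart_jac_neq0.
have Dc : {for x, continuous (fun y => D x * D y)}.
  apply: continuousM; first exact: cst_continuous.
  rewrite (funext DE0); exact: (det_chart_jac_continuous (ccr j i) xi xj).
have DD : \forall y \near x, 0 < D x * D y.
  by apply: (cvgr_gt _ Dc); rewrite -expr2 exprn_even_gt0.
near=> y.
have yi : dom (atlas i) y by near: y; exact: dom_near.
have yj : dom (c j) y by near: y; exact: dom_near.
have Dy : 0 < D x * D y by near: y.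
have [k' k'0 ->] := DE y yi yj.
by rewrite mulrACA mulr_gt0 // mulr_gt0.
Unshelve. all: by end_near. Qed.

Opaque frame_det.

Definition reflection : 'M[R]_m :=
  diag_mx (\row_a (if a == Ordinal m_gt0 then -1 else 1)).

Lemma reflection_sqr : reflection *m reflection = 1%:M.
Proof.
rewrite /reflection mulmx_diag; apply/matrixP => a b; rewrite !mxE.
by case: (a == Ordinal m_gt0); rewrite ?mulrNN ?mulr1.
Qed.

Lemma det_reflection : \det reflection = -1.
Proof.
rewrite det_diag (bigD1 (Ordinal m_gt0)) //= mxE eqxx big1 ?mulr1 // => a ai.
by rewrite mxE (negPf ai).
Qed.

(** Restrict each chart to the open set where its sign is positive, and
    reflect it on the one where its sign is negative. *)
Lemma sign_orientable o : orientation_sign o -> orientable M.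
Proof.
move=> [sg_neq0 os].
pose w i x := o x * frame_det i x.
(* The boolean tells the reflected charts. *)
pose V (p : atlas_idx M * bool) : set M :=
  [set x | dom (atlas p.1) x /\ 0 < (-1) ^+ p.2 * w p.1 x].
have Vo p : open (V p).
  rewrite openE => x [xi wx]; rewrite /interior.
  near=> y; split; first by near: y; exact: dom_near.
  have : 0 < w p.1 x * w p.1 y by near: y; exact: os.
  move: wx; move: (w p.1 x) (w p.1 y) => a b.
  case: p.2; rewrite ?expr1 ?expr0 ?mulN1r ?mul1r ?oppr_gt0.
    by move=> wx; rewrite nmulr_rgt0.
  by move=> wx; rewrite pmulr_rgt0.
pose A (p : atlas_idx M * bool) : 'M[R]_m := if p.2 then reflection else 1%:M.
have AA p : A p *m A p = 1%:M.
  by rewrite /A; case: ifP; rewrite ?reflection_sqr ?mulmx1.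
have detA p : \det (A p) = (-1) ^+ p.2.
  by rewrite /A; case: p.2; rewrite ?det_reflection ?det1 ?expr1 ?expr0.
pose c p := twist (atlas p.1) (Vo p) (AA p).
have at_x (x : M) : dom (chart_at x) x by exact: chart_idx_atP.
have ccl p i : compatible (c p) (atlas i).
  by apply: twist_compatible_l; exact: atlas_compatible.
have ccr p i : compatible (atlas i) (c p).
  by apply: twist_compatible_r; exact: atlas_compatible.
exists (atlas_idx M * bool)%type, c; split.
- by move=> p i; split; [exact: ccl|exact: ccr].
- move=> x; pose i := chart_idx_at x; have xi : dom (atlas i) x := at_x x.
  have w0 : w i x != 0 by rewrite mulf_neq0 ?sg_neq0 ?frame_det_neq0.
  exists (i, w i x < 0); split=> //; split=> //=.
  move: w0; move: (w i x) => a w0.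
  case: (boolP (a < 0)) => wa; first by rewrite expr1 mulN1r oppr_gt0.
  by rewrite expr0 mul1r lt0r w0 leNgt.
move=> p p' x xp xp'.
have pos p1 : dom (c p1) x -> 0 < o x * \det (chart_jac (c p1) (chart_at x) x).
  move=> xp1; rewrite det_chart_jac_twist //; last exact: atlas_compatible.
  have wx : 0 < (-1) ^+ p1.2 * (o x * frame_det p1.1 x) := xp1.2.2.
  rewrite detA -frame_detE.
  by move: wx; move: (o x) (frame_det _ _) (_ ^+ _) => a1 a2 a3; rewrite mulrCA.
have E : \det (chart_jac (c p) (chart_at x) x) =
    \det (chart_jac (c p) (c p') x) * \det (chart_jac (c p') (chart_at x) x).
  rewrite -det_mulmx; congr (\det _).
  apply: (chart_jac_chain xp xp'); last first.
    by apply: differentiable_transition => //; exact: ccl.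
  apply: (differentiable_transition_chain xp (at_x x)).
    by apply: differentiable_transition => //; exact: ccl.
  by apply: differentiable_transition => //; exact: ccr.
have alg (a b e f : R) : 0 < a * e -> 0 < a * f -> e = b * f -> 0 < b.
  by move=> ae af eb; move: ae; rewrite eb mulrCA pmulr_lgt0.
exact: alg (pos p xp) (pos p' xp') E.
Unshelve. all: by end_near. Qed.

End Orientation.

(** * Subbundles spanned by smooth local frames *)

Section LeftInverse.
Variable R : rcfType.
Local Notation C := R[i].

Lemma unitmx_col_inj (K : fieldType) n (A : 'M[K]_n) :
  (forall u : 'cV_n, A *m u = 0 -> u = 0) -> A \in unitmx.
Proof.
move=> A0; rewrite -unitmx_tr -row_free_unit; apply: inj_row_free => v vA.
by apply: trmx_inj; rewrite trmx0; apply: A0; rewrite -[A]trmxK -trmx_mul vA trmx0.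
Qed.

Definition adjmx p n (A : 'M[C]_(p, n)) : 'M[C]_(n, p) := (map_mx conjc A)^T.

Lemma adjmx_norm_eq0 p (v : 'cV[C]_p) : adjmx v *m v = 0 -> v = 0.
Proof.
move=> /matrixP/(_ 0 0); rewrite !mxE => s0.
have : \sum_i (complex.Re (v i 0) ^+ 2 + complex.Im (v i 0) ^+ 2) = 0.
  have := congr1 (@complex.Re R) s0; rewrite raddf_sum /= => {2}<-.
  by apply: eq_bigr => i _; rewrite !mxE; case: (v i 0) => a b /=; rewrite mulNr opprK !expr2.
move/eqP; rewrite psumr_eq0 => [/allP n0|i _]; last by rewrite addr_ge0 ?sqr_ge0.
apply/colP => i; have := n0 i (mem_index_enum i); rewrite /= mxE.
case: (v i 0) => a b; rewrite paddr_eq0 ?sqr_ge0 // !sqrf_eq0 /=.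
by move=> /andP[/eqP-> /eqP->].
Qed.

Lemma adjmxM p n q (A : 'M[C]_(p, n)) (B : 'M[C]_(n, q)) :
  adjmx (A *m B) = adjmx B *m adjmx A.
Proof. by rewrite /adjmx map_mxM trmx_mul. Qed.

Definition col_inj p n (A : 'M[C]_(p, n)) := forall u : 'cV_n, A *m u = 0 -> u = 0.

Lemma col_inj_rank p r (F : 'M[C]_(p, r)) : col_inj F -> \rank F = r.
Proof.
move=> Fi; rewrite -mxrank_tr; apply/eqP; rewrite -[_ == _]/(row_free F^T).
apply: inj_row_free => v vF; apply: trmx_inj; rewrite trmx0; apply: Fi.
by rewrite -[F]trmxK -trmx_mul vF trmx0.
Qed.

(** A right inverse of the row factor in a rank factorisation selects
    independent columns. *)
Lemma full_col_factor p n r (A : 'M[C]_(p, n)) : \rank A = r ->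
  exists U : 'M[C]_(n, r), col_inj (A *m U).
Proof.
move=> <-; exists (pinvmx (row_base A)).
have -> : A *m pinvmx (row_base A) = col_base A.
  rewrite -[X in X *m _ = _]mulmx_base -mulmxA mulmxVp ?row_base_free //.
  by rewrite mulmx1.
move=> u Au0; have /row_fullP[L LA] := col_base_full A.
by rewrite -[u]mul1mx -LA -mulmxA Au0 mulmx0.
Qed.

(** A left inverse given by a formula in the entries and their conjugates, so
    that it depends smoothly on the matrix. *)
Definition left_inverse_mx p n (A : 'M[C]_(p, n)) : 'M[C]_(n, p) :=
  invmx (adjmx A *m A) *m adjmx A.

(** The Gram matrix of independent columns for the Hermitian form is
    invertible. *)
Lemma adjmx_unit p n (A : 'M[C]_(p, n)) : col_inj A -> adjmx A *m A \in unitmx.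
Proof.
move=> A0; apply: unitmx_col_inj => u AAu; apply: A0; apply: adjmx_norm_eq0.
by rewrite adjmxM -mulmxA [adjmx A *m _]mulmxA AAu mulmx0.
Qed.

Lemma left_inverse_mxK p n (A : 'M[C]_(p, n)) : col_inj A ->
  left_inverse_mx A *m A = 1%:M.
Proof. by move=> A0; rewrite /left_inverse_mx -mulmxA mulVmx ?adjmx_unit. Qed.

End LeftInverse.

Section Subbundle.
Variables (R : realType) (m : nat) (M : manifold R m) (Sigma : cvbundle M).
Local Notation C := R[i].

Lemma cmsmooth_left_inverse (U : set M) p n (h : M -> 'M[C]_(p, n)) : open U ->
  (forall x, U x -> col_inj (h x)) -> cmsmooth U h ->
  cmsmooth U (fun x => left_inverse_mx (h x)).
Proof.
move=> Uo hi hU; have aU := cmsmooth_adj Uo hU.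
apply: cmsmoothM => //; apply: cmsmoothV => //; last exact: cmsmoothM.
by move=> x Ux; apply: adjmx_unit; exact: hi.
Qed.

Lemma frame_change : exists t : vidx Sigma -> vidx Sigma -> M -> 'M[C]_(vrank Sigma),
  forall j k, cmsmooth (vdom j `&` vdom k) (t j k) /\
    forall x u, vdom j x -> vdom k x ->
      vframe j x u = vframe k x (t j k x *m u).
Proof.
have /choice[t tP] := fun p : vidx Sigma * vidx Sigma => vframe_smooth p.1 p.2.
by exists (fun j k => t (j, k)) => j k; exact: tP (j, k).
Qed.

Lemma linear_frame_mx x k (L : Sigma x -> Sigma x) : vdom k x -> linear L ->
  exists A : 'M[C]_(vrank Sigma), forall u, L (vframe k x u) = vframe k x (A *m u).
Proof.
move=> xk lL; have [f fK Kf] := vframe_bij xk.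
have lf := linear_inverse (linearP (vframe k x)) fK Kf.
have [|A AE] := @linear_col _ _ _ (fun u => f (L (vframe k x u))).
  by move=> c u v; rewrite linearP lL lf.
by exists A => u; rewrite -AE Kf.
Qed.

Lemma frame_mx_inj x k p (A B : 'M[C]_(vrank Sigma, p)) : vdom k x ->
  (forall u, vframe k x (A *m u) = vframe k x (B *m u)) -> A = B.
Proof.
move=> xk AB; apply/matrixP => a b.
have := bij_inj (vframe_bij xk) (AB (delta_mx b 0)).
by rewrite -!colE => /colP/(_ a); rewrite !mxE.
Qed.

Variables (r : nat) (E : forall x, set (Sigma x)).
Arguments E : clear implicits.

(** These frames, all together, index the trivialisations in
    [subbundle_exists]; so the frame chosen at each point may vary without any
    regularity. *)
Record local_frame := LocalFrame {
  lf_dom : set M;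
  lf_idx : vidx Sigma;
  lf_mx : M -> 'M[C]_(vrank Sigma, r);
  lf_open : open lf_dom;
  lf_sub : lf_dom `<=` vdom lf_idx;
  lf_smooth : cmsmooth lf_dom lf_mx;
  lf_inj : forall x, lf_dom x -> col_inj (lf_mx x);
  lf_range : forall x, lf_dom x ->
    E x = range (fun u => vframe lf_idx x (lf_mx x *m u))
}.

Hypothesis lf_cover : forall x, exists f : local_frame, lf_dom f x.

(** The subbundle has all local frames of [E] as its trivialisations. Its
    fibre at [x] is C^r, identified with the subspace at [x] by a frame [fx x]
    chosen at [x]; the trivialisation attached to a frame [f] is then the
    change of frame from [f] to [fx x]. Changes of frame are smooth by the
    formula of [left_inverse_mx]. *)
Lemma subbundle_exists : exists (P : cvbundle M) (iP : forall x, P x -> Sigma x),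
  [/\ vrank P = r, forall x, linear (iP x), forall x, injective (iP x),
      forall x, E x = range (iP x) & smooth_hom setT iP].
Proof.
have [t tP] := frame_change.
have /choice[fx fxP] := lf_cover.
pose iota f x (u : 'cV[C]_r) : Sigma x := vframe (lf_idx f) x (lf_mx f x *m u).
have iotaB f x u v : iota f x (u - v) = iota f x u - iota f x v.
  by rewrite /iota mulmxBr linearB.
have iota_inj f x : lf_dom f x -> injective (iota f x).
  move=> xf u v uv; apply/eqP; rewrite -subr_eq0; apply/eqP.
  apply: (lf_inj xf); apply: (bij_inj (vframe_bij (lf_sub xf))).
  by rewrite linear0 -[LHS]/(iota f x (u - v)) iotaB uv subrr.
pose chg f g x : 'M[C]_r :=
  left_inverse_mx (lf_mx g x) *m t (lf_idx f) (lf_idx g) x *m lf_mx f x.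
have chgP f g x u : lf_dom f x -> lf_dom g x -> iota f x u = iota g x (chg f g x *m u).
  move=> xf xg; have Eu : E x (iota f x u) by rewrite (lf_range xf); exists u.
  rewrite (lf_range xg) in Eu; have [v _ vu] := Eu.
  have [_ tfg] := tP (lf_idx f) (lf_idx g).
  suff <- : v = chg f g x *m u by rewrite -vu.
  have : vframe (lf_idx g) x (lf_mx g x *m v) =
      vframe (lf_idx g) x (t (lf_idx f) (lf_idx g) x *m (lf_mx f x *m u)).
    rewrite vu; apply: tfg; [exact: lf_sub xf|exact: lf_sub xg].
  move/(bij_inj (vframe_bij (lf_sub xg))) => gv.
  have -> : chg f g x *m u = left_inverse_mx (lf_mx g x) *m
      (t (lf_idx f) (lf_idx g) x *m (lf_mx f x *m u)) by rewrite /chg !mulmxA.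
  by rewrite -gv [RHS]mulmxA left_inverse_mxK ?mul1mx //; exact: lf_inj.
have chg_smooth f g : cmsmooth (lf_dom f `&` lf_dom g) (chg f g).
  have Uo : open (lf_dom f `&` lf_dom g) by apply: openI; exact: lf_open.
  apply: cmsmoothM => //; last by apply: cmsmooth_sub (lf_smooth f) => x [].
  apply: cmsmoothM => //.
    apply: cmsmooth_left_inverse => //; first by move=> x [_ xg]; exact: lf_inj.
    by apply: cmsmooth_sub (lf_smooth g) => x [].
  have [ts _] := tP (lf_idx f) (lf_idx g); apply: cmsmooth_sub ts => x [xf xg].
  by split; exact: lf_sub.
pose vf (f : local_frame) (x : M) : {linear 'cV[C]_r -> 'cV[C]_r} :=
  mulmx (chg f (fx x) x).
have iota_vf f x u : lf_dom f x -> iota (fx x) x (vf f x u) = iota f x u.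
  by move=> xf; rewrite /vf /= -chgP.
have vf_bij f x : lf_dom f x -> bijective (vf f x).
  move=> xf; exists (mulmx (chg (fx x) f x)) => u.
    by apply: (iota_inj f x xf); rewrite -chgP // iota_vf.
  by apply: (iota_inj (fx x) x (fxP x)); rewrite iota_vf // -chgP.
have vf_smooth f g : exists h : M -> 'M[C]_r,
    cmsmooth (lf_dom f `&` lf_dom g) h /\
    forall x u, lf_dom f x -> lf_dom g x -> vf f x u = vf g x (h x *m u).
  exists (chg f g); split=> // x u xf xg.
  by apply: (iota_inj (fx x) x (fxP x)); rewrite !iota_vf // -chgP.
pose P : cvbundle M := @CVBundle R m M r (fun=> 'cV[C]_r) local_frame lf_dom vf
  lf_open lf_cover vf_bij vf_smooth.
exists P, (fun x u => iota (fx x) x u); split=> //.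
- by move=> x c u v; rewrite /iota mulmxDr -scalemxAr linearP.
- by move=> x; exact: iota_inj.
- by move=> x; exact: lf_range.
move=> f k; exists (fun x => t (lf_idx f) k x *m lf_mx f x); split.
  have Uo : open (lf_dom f `&` vdom k) by apply: openI; [exact: lf_open|exact: vdom_open].
  rewrite setTI; apply: cmsmoothM => //; last by apply: cmsmooth_sub (lf_smooth f) => x [].
  have [ts _] := tP (lf_idx f) k; apply: cmsmooth_sub ts => x [xf xk].
  by split=> //; exact: lf_sub xf.
move=> x u _ xf xk; rewrite [LHS]iota_vf // -mulmxA.
by have [_ tfk] := tP (lf_idx f) k; apply: tfk => //; exact: lf_sub xf.
Qed.

End Subbundle.

(** * The volume field of a spinor bundle and its eigenbundles *)

Section RepBig.
Variables (R : realType) (V : lmodType R) (q : V -> R) (F : lmodType R[i]).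
Variable tau : Cl q -> F -> F.
Hypothesis tau_rep : is_rep setT tau.

Lemma rep_opp a u : tau (- a) u = - tau a u.
Proof.
have [_ _ tZ _ _] := tau_rep.
by rewrite -scaleN1r tZ // rmorphN1 scaleN1r.
Qed.

Lemma rep_sum (I : Type) (r : seq I) (f : I -> Cl q) u :
  tau (\sum_(i <- r) f i) u = \sum_(i <- r) tau (f i) u.
Proof.
have [_ tD tZ _ _] := tau_rep.
elim: r => [|i r IH]; last by rewrite !big_cons tD // IH.
by rewrite !big_nil -(scale0r (1 : Cl q)) tZ // rmorph0 scale0r.
Qed.

Lemma rep_sign (b : bool) a u : tau ((-1) ^+ b * a) u = (-1) ^+ b *: tau a u.
Proof.
by case: b; rewrite ?expr1 ?expr0 ?mulN1r ?mul1r ?scale1r // scaleN1r rep_opp.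
Qed.
End RepBig.

Section VolumeField.
Variables (R : realType) (m : nat) (M : manifold R m) (g : metric M).
Variables (Sigma : cvbundle M) (tau : forall x : M, Clg g x -> Sigma x -> Sigma x).
Arguments tau : clear implicits.
Hypothesis m_gt0 : (0 < m)%N.
Hypothesis htau : algebra_bundle_hom tau.
Hypothesis htype : forall x : M,
  if odd m then Cartan_type m./2 (tau x) else Dirac_type m./2 (tau x).
Local Notation C := R[i].
Local Notation N := (vrank Sigma).

Definition vol (x : M) : Clg g x := clvol (quad g (x := x)) 1%:M.
Definition vol_square (x : M) : R := volume_cst R m * \det (gram g x).
Definition frame_vol (i : atlas_idx M) (x : M) : Clg g x :=
  clvol (quad g (x := x)) (chart_jac (atlas i) (chart_at x) x).

Let qE x (v : 'rV[R]_m) : quad g (x := x) v = (v *m gram g x *m v^T) 0 0.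
Proof. by []. Qed.

Lemma frame_volE i x : frame_vol i x = frame_det i x *: vol x.
Proof. by rewrite frame_detE -clvol_mul mulmx1. Qed.

Lemma vol_swap x : exists T, chirality_swap (vol x) (tau x) T.
Proof.
have := htype x; case: ifPn => mo.
  move=> [sigma [srep [_ _ sirr] seq]].
  have r0 : (0 < 2 ^ m./2)%N by rewrite expn_gt0.
  have [T Tsw] := Cartan_chirality_swap (@qE x) (gram_sym g x)
    (gram_nondegenerate g x) r0 mo srep sirr.
  exact: chirality_swap_equiv seq Tsw.
move=> [delta [[drep _ dirr] deq]].
have [T Tsw] := Dirac_chirality_swap (@qE x) (gram_sym g x)
  (gram_nondegenerate g x) m_gt0 mo drep dirr.
exact: chirality_swap_equiv deq Tsw.
Qed.

Lemma Sigma_nontrivial x : exists u : Sigma x, u <> 0.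
Proof.
have nz (F : lmodType C) (rho : Clg g x -> F -> F) :
    (exists u : F, u <> 0) -> equivalent rho (tau x) -> exists u : Sigma x, u <> 0.
  move=> [u u0] [J [lJ [I JK IK] _]]; exists (J u) => Ju0; apply: u0.
  by apply: (can_inj JK); rewrite Ju0 (linear_fun0 lJ).
have := htype x; case: ifPn => mo.
  move=> [sigma [_ [_ _ [[u u0] _]] seq]]; apply: (nz _ _ _ seq).
  by exists (u, 0) => -[].
by move=> [delta [[_ _ [[u u0] _]] deq]]; apply: (nz _ _ _ deq); exists u.
Qed.

(** The coordinate fields act smoothly, and the volume element is a fixed
    polynomial in them. *)
Lemma frame_vol_smooth i k : exists a : M -> 'M[C]_N,
  cmsmooth (dom (atlas i) `&` vdom k) a /\
  forall x u, dom (atlas i) x -> vdom k x ->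
    tau x (frame_vol i x) (vframe k x u) = vframe k x (a x *m u).
Proof.
have [trep tsm] := htau.
have Uo : open (dom (atlas i) `&` vdom k) by apply: openI; [exact: dom_open|exact: vdom_open].
have /choice[h hP] : forall b : 'I_m, exists h : M -> 'M[C]_N,
    cmsmooth (dom (atlas i) `&` vdom k) h /\
    forall x u, dom (atlas i) x -> vdom k x ->
      tau x (cl_gen (quad g (x := x)) (coord_field (atlas i) b x)) (vframe k x u) =
      vframe k x (h x *m u).
  move=> b; have [h [hs hE]] := tsm i [set b]%SET k k; exists h; split.
    by apply: cmsmooth_sub hs => x [].
  by move=> x u xi xk; rewrite -(hE x u xi xk xk) /Clg_frame big_set1.
have wordE (r : seq 'I_m) (s : 'I_m -> 'I_m) x u : dom (atlas i) x -> vdom k x ->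
    tau x (\prod_(b <- r) cl_gen (quad g (x := x)) (coord_field (atlas i) (s b) x))
      (vframe k x u) = vframe k x ((\prod_(b <- r) h (s b) x) *m u).
  move=> xi xk; have [_ _ _ tM t1] := trep x.
  elim: r u => [|b r IH] u; first by rewrite !big_nil t1 mul1mx.
  rewrite !big_cons tM // IH; have [_ ->] := hP (s b) => //.
  by rewrite mulmxA.
exists (fun x => \sum_(s : 'S_m) (-1) ^+ s *: \prod_b h (s b) x); split.
  apply: cmsmooth_sum => // s; apply: cmsmoothZ => //; first exact: csmooth_cst.
  elim: (index_enum 'I_m) => [|b r IH].
    by under eq_fun do rewrite big_nil; exact: cmsmooth_cst.
  under eq_fun do rewrite big_cons.
  by apply: cmsmoothM => //; have [] := hP (s b).
move=> x u xi xk; rewrite /frame_vol /clvol /volume (rep_sum (trep x)).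
rewrite mulmx_suml linear_sum; apply: eq_bigr => s _.
rewrite (rep_sign (trep x)) -scalemxAl linearZ; congr (_ *: _).
exact: wordE.
Qed.

Lemma vol_properties x :
  [/\ clifford_d (vol x), forall a, clifford_d a -> vol x * a = a * vol x,
      vol x * vol x = vol_square x *: (1 : Clg g x) & vol_square x != 0].
Proof.
split.
- exact: clifford_d_vol.
- exact: (vol_comm (@qE x) (gram_sym g x)).
- exact: (vol_sqr (@qE x) (gram_sym g x)).
- exact: (vol_square_neq0 (gram_nondegenerate g x)).
Qed.

(** The orientation at [x] is the sign of the scalar [lam x] by which [vol x]
    acts on the first summand, read off its real or its imaginary part
    according to the sign of its square. *)
Lemma decomposable_sign : decomposable (@Cld R m M g) tau ->
  exists o : M -> R, orientation_sign o.
Proof.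
move=> [P [Q [iP [iQ [[P0 Q0] lin [smP _] bijPQ inv]]]]].
have lP x : linear (iP x) by have [] := lin x.
have lQ x : linear (iQ x) by have [] := lin x.
have iP_inj x : injective (iP x).
  move=> p p' pp'; have /bij_inj inj := bijPQ x.
  by have [] : (p, 0 : Q x) = (p', 0) by apply: inj; rewrite /= pp'.
have lamP x : exists lam : C, lam ^+ 2 = (vol_square x)%:C%C /\
    forall p, tau x (vol x) (iP x p) = lam *: iP x p.
  have [j xj] := vdom_cover P x; have [k xk] := vdom_cover Q x.
  have [T Tsw] := vol_swap x; have [vin vcomm vsqr _] := vol_properties x.
  have bj := vframe_bij xj; have bk := vframe_bij xk.
  have [||||lam lam2 lamE] := volume_scalar_on_summand (htau.1 x) Tsw vin vcomm vsqr
    (e := iP x \o vframe j x) P0.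
  - by move=> c u v /=; rewrite linearP lP.
  - by apply: inj_comp => //; exact: bij_inj.
  - move=> a u Sa; have [+ _] := inv x a Sa => /(_ (vframe j x u))[p' ->].
    have [f _ fK] := bj; exists (f p'); by rewrite /= fK.
  - exists (iQ x (vframe k x (const_mx 1))) => u /= eQ.
    have /bij_inj inj := bijPQ x.
    have : (vframe j x u, 0 : Q x) = (0, vframe k x (const_mx 1)).
      by apply: inj; rewrite /= -eQ (linear_fun0 (lQ x)) (linear_fun0 (lP x)) addr0 add0r.
    move=> [_] /esym vk0.
    have /colP/(_ (Ordinal Q0)) : const_mx 1 = 0 :> 'cV[C]_(vrank Q).
      by apply: (bij_inj bk); rewrite vk0 linear0.
    by rewrite !mxE => /eqP; rewrite oner_eq0.
  exists lam; split=> // p; have [f _ fK] := bj.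
  by have := lamE (f p); rewrite /= fK.
have /choice[lam lamE] := lamP.
pose o x := complex.Re (lam x) + complex.Im (lam x).
have sg0 x : o x != 0.
  have [lam2 _] := lamE x; have [_ _ _ v0] := vol_properties x.
  exact: sqr_real_Re_Im lam2 v0.
exists o; split=> // i x xi.
have [j xj] := vdom_cover P x; have [k xk] := vdom_cover Sigma x.
have [hP [hPs hPE]] := smP j k.
have [a [as_ aE]] := frame_vol_smooth i k.
pose lami y : C := (frame_det i y)%:C%C * lam y.
pose W := dom (atlas i) `&` (vdom j `&` vdom k).
have Wo : open W.
  by apply: openI; [exact: dom_open|apply: openI; exact: vdom_open].
have Wx : W x by [].
have hPW : cmsmooth W hP by apply: cmsmooth_sub hPs => y [_ [yj yk]].
have aW : cmsmooth W a by apply: cmsmooth_sub as_ => y [yi [_ yk]].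
have ahP y : W y -> a y *m hP y = lami y *: hP y.
  move=> [yi [yj yk]]; apply/matrixP => b c.
  have bk := vframe_bij yk.
  have E (u : 'cV_(vrank P)) : a y *m hP y *m u = (lami y *: hP y) *m u.
    apply: (bij_inj bk); rewrite -mulmxA -aE // -hPE // frame_volE.
    have [_ _ tZ _ _] := htau.1 y; rewrite tZ // (lamE y).2 scalerA hPE //.
    by rewrite -scalemxAl linearZ.
  have := E (delta_mx c 0) => /colP/(_ b); rewrite -!colE.
  by rewrite !mxE.
have hPx0 : exists b c, hP x b c != 0.
  apply: contrapT => /forallNP hP0.
  have hPx : hP x = 0.
    apply/matrixP => b c; rewrite [RHS]mxE; apply/eqP/negPn/negP => h.
    by apply: (hP0 b); exists c.
  have : iP x (vframe j x (const_mx 1)) = iP x (vframe j x 0).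
    by rewrite !hPE // hPx !mul0mx.
  move/iP_inj/(bij_inj (vframe_bij xj))/colP/(_ (Ordinal P0)).
  by rewrite !mxE => /eqP; rewrite oner_eq0.
(* A non-zero entry of the matrix of the inclusion of the first summand: there,
   the equation [ahP] expresses [lami] as a quotient of smooth functions. *)
have [b [c hP0]] := hPx0.
pose U := W `&` [set y | hP y b c != 0].
have Uo : open U.
  rewrite openE => y [Wy hy]; apply: filterI; first exact: open_nbhs_nbhs.
  exact: (csmooth_neq0_near Wo (hPW b c) Wy hy).
have lamU : csmooth U lami.
  have UW : U `<=` W by move=> y [].
  have hU : csmooth U (fun y => (hP y b c)^-1).
    apply: csmoothV => //; first by move=> y [].
    exact: csmooth_sub UW (hPW b c).
  have ahU : csmooth U (fun y => (a y *m hP y) b c).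
    by apply: csmooth_sub UW _; exact: (cmsmoothM Wo aW hPW b c).
  apply: csmooth_eq (csmoothM Uo ahU hU) => // y [Wy hy].
  by rewrite ahP // mxE mulfK.
pose f y := complex.Re (lami y) + complex.Im (lami y).
have fE y : f y = o y * frame_det i y.
  rewrite /f /lami /o; move: (frame_det i y) (lam y) => d [r1 r2] /=.
  by ring.
have fU : msmooth U (fun y => f x * f y).
  apply: msmoothM => //; first exact: msmooth_cst.
  by apply: msmoothD => //; [exact: lamU.1|exact: lamU.2].
have ff0 : 0 < f x * f x.
  by rewrite -expr2 exprn_even_gt0 //= fE mulf_neq0 // frame_det_neq0.
have Ux : U x by [].
apply: filterS (msmooth_gt0_near Uo fU Ux ff0) => y.
by rewrite !fE.
Qed.

Section FromOrientation.
Variable o : M -> R.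
Hypothesis o_sign : orientation_sign o.

(** Its square is the inverse of [vol_square x] ([chi_coef_sqr]), and it has
    the sign of [o x]: together with the orientation, this makes the product
    with [vol x] independent of the basis of the tangent space. *)
Definition chi_coef (x : M) : C :=
  (Num.sg (o x) / Num.sqrt `|vol_square x|)%:C%C * (if 0 < vol_square x then 1 else 'i%C).

Definition chi x (u : Sigma x) : Sigma x := chi_coef x *: tau x (vol x) u.

Lemma chi_linear x : linear (@chi x).
Proof.
have [tl _ _ _ _] := htau.1 x.
by move=> c u v; rewrite /chi (tl _ I) scalerDr !scalerA mulrC.
Qed.

Lemma chi_coef_sqr x : chi_coef x * chi_coef x * (vol_square x)%:C%C = 1.
Proof.
have [sg0 _] := o_sign; have [_ _ _ v0] := vol_properties x.
have s0 : Num.sqrt `|vol_square x| != 0 by rewrite sqrtr_eq0 -ltNge normr_gt0.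
have ss : Num.sqrt `|vol_square x| * Num.sqrt `|vol_square x| = `|vol_square x|.
  by rewrite -expr2 sqr_sqrtr.
rewrite /chi_coef mulrACA -rmorphM mulf_div ss -expr2 sqr_sg sg0 mulrAC -rmorphM.
case: ifP => vp.
  by rewrite gtr0_norm // !mulr1 mul1r mulVf.
have vn : vol_square x < 0 by rewrite lt_neqAle v0 leNgt vp.
rewrite ltr0_norm // -expr2 sqr_i mul1r invrN mulNr mulVf //.
by rewrite rmorphN1 mulrNN mulr1.
Qed.

Lemma chiK x : involutive (@chi x).
Proof.
move=> u; have [tl _ tZ tM t1] := htau.1 x; have [_ _ vsqr _] := vol_properties x.
rewrite /chi (linear_funZ (tl _ I)) scalerA -tM // vsqr tZ // t1 scalerA.
by rewrite chi_coef_sqr scale1r.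
Qed.

Lemma chi_commutes x a u : clifford_d a -> tau x a (chi u) = chi (tau x a u).
Proof.
move=> Sa; have [tl _ _ tM _] := htau.1 x; have [_ vcomm _ _] := vol_properties x.
by rewrite /chi (linear_funZ (tl a I)) -!tM // vcomm.
Qed.

(** This is the square of [frame_vol i x], hence up to a constant the
    determinant of the Gram matrix of the coordinate fields. *)
Lemma frame_vol_square_smooth i :
  msmooth (dom (atlas i)) (fun x => frame_det i x ^+ 2 * vol_square x).
Proof.
have dom_o := dom_open (atlas i).
pose Gi x : 'M[R]_m := \matrix_(a, b)
  (coord_field (atlas i) a x *m gram g x *m (coord_field (atlas i) b x)^T) 0 0.
have GiE x : \det (Gi x) = frame_det i x ^+ 2 * \det (gram g x).
  have -> : Gi x = chart_jac (atlas i) (chart_at x) x *m gram g x *m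
      (chart_jac (atlas i) (chart_at x) x)^T.
    apply/matrixP => a b; rewrite mxE tr_row colE mulmxA -!row_mul -colE.
    by rewrite [LHS]mxE [LHS]mxE.
  by rewrite !det_mulmx det_tr -frame_detE expr2 mulrAC.
apply: (msmooth_eq (f := fun x => volume_cst R m * \det (Gi x))) => //.
  by move=> x _; rewrite GiE /vol_square mulrCA.
apply: msmoothM => //; first exact: msmooth_cst.
apply: msmooth_det => // a b; apply: msmooth_eq (gram_smooth g i a b) => // x _.
by rewrite [RHS]mxE.
Qed.

(** [chi_coef] is not smooth, as [vol] is not; but [chi] is [s] times the
    smooth [frame_vol]. On a neighbourhood where the signs of [o * frame_det]
    and of [vol_square] do not change, [s] is a constant times the inverse
    square root of a positive smooth function. *)
Lemma chi_coef_smooth i x0 : dom (atlas i) x0 -> exists (W : set M) (s : M -> C),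
  [/\ open W, W x0, W `<=` dom (atlas i), csmooth W s &
      forall y, W y -> chi_coef y = s y * (frame_det i y)%:C%C].
Proof.
move=> xi; have [sg0 os] := o_sign.
pose w y := o y * frame_det i y.
pose D y := frame_det i y ^+ 2 * vol_square y.
have Ds : msmooth (dom (atlas i)) (fun y => vol_square x0 * D y).
  by apply: msmoothM; [exact: dom_open|exact: msmooth_cst|exact: frame_vol_square_smooth].
pose W := [set y | dom (atlas i) y /\ 0 < w x0 * w y /\ 0 < vol_square x0 * D y].
have v0 y : vol_square y != 0 by have [] := vol_properties y.
have fd0 y : dom (atlas i) y -> frame_det i y != 0 by move=> yi; exact: frame_det_neq0.
have Wo : open W.
  rewrite openE => y [yi [wy Dy]]; rewrite /interior.
  near=> z; split; first by near: z; exact: dom_near.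
  split; last by near: z; apply: (msmooth_gt0_near (dom_open _) Ds yi Dy).
  have : 0 < w y * w z by near: z; exact: os.
  move: wy; move: (w x0) (w y) (w z) => a b d ab bd.
  have : 0 < (a * b) * (b * d) by exact: mulr_gt0.
  rewrite (_ : _ * _ = b ^+ 2 * (a * d)); last by ring.
  by apply: contraTT; rewrite -!leNgt => ad; rewrite mulr_ge0_le0 ?sqr_ge0.
have Wx : W x0.
  split=> //; split.
    by rewrite -expr2 exprn_even_gt0 //= mulf_neq0 ?sg0 ?fd0.
  by rewrite /D mulrCA -expr2 mulr_gt0 ?exprn_even_gt0 //= ?fd0 ?v0.
pose z0 : C := if 0 < vol_square x0 then 1 else 'i%C.
pose s y : C := (Num.sg (w x0) * (Num.sqrt (Num.sg (vol_square x0) * D y))^-1)%:C%C * z0.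
have sg_eq (a b : R) : 0 < a * b -> Num.sg b = Num.sg a.
  move=> ab; have : Num.sg a * Num.sg b = 1 by rewrite -sgrM gtr0_sg.
  have a0 : a != 0 by apply: contraTneq ab => ->; rewrite mul0r ltxx.
  have s2 : Num.sg a * Num.sg a = 1 by rewrite -expr2 sqr_sg a0.
  by move=> e; rewrite -[LHS]mul1r -s2 -mulrA e mulr1.
exists W, s; split=> //; first by move=> y [].
  apply: csmoothM => //; last exact: csmooth_cst.
  apply: csmooth_real; apply: msmoothM => //; first exact: msmooth_cst.
  have Di : msmooth W D by apply: msmooth_sub (frame_vol_square_smooth i) => y [].
  apply: msmooth_sqrtV => //; last by apply: msmoothM => //; exact: msmooth_cst.
  move=> y [yi [_ Dy]]; rewrite -(sg_eq _ _ Dy) -normrEsg normr_gt0.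
  by rewrite mulf_neq0 ?expf_neq0 ?fd0 ?v0.
move=> y [yi [wy Dy]].
have vy : 0 < vol_square x0 * vol_square y.
  move: Dy; rewrite /D mulrCA pmulr_rgt0 // exprn_even_gt0 //=.
  exact: fd0.
have sv : Num.sg (vol_square y) = Num.sg (vol_square x0) := sg_eq _ _ vy.
have vpos : (0 < vol_square x0) = (0 < vol_square y) by rewrite -!sgr_cp0 sv.
rewrite /chi_coef /s /z0 vpos.
rewrite [RHS]mulrAC -rmorphM; congr (_%:C%C * _).
rewrite -(sg_eq _ _ wy) /w sgrM -sv /D mulrCA -normrEsg.
rewrite sqrtrM ?sqr_ge0 // sqrtr_sqr.
have fdE : Num.sg (frame_det i y) * frame_det i y = `|frame_det i y| by rewrite -normrEsg.
have fn0 : `|frame_det i y| != 0 by rewrite normr_eq0 fd0.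
have s0 : Num.sqrt `|vol_square y| != 0 by rewrite sqrtr_eq0 -ltNge normr_gt0 v0.
rewrite invfM; move: fdE fn0 s0; move: (Num.sg (o y)) (Num.sg (frame_det i y)).
move: (frame_det i y) (`|_|) (Num.sqrt _) => d n q so sd dE n0 q0.
rewrite (_ : so * sd * (n^-1 * q^-1) * d = so * (sd * d) * n^-1 * q^-1); last by ring.
by rewrite dE; field; rewrite n0 q0.
Unshelve. all: by end_near. Qed.

Definition chi_space (e : C) x : set (Sigma x) := [set p | chi p = e *: p].

Lemma chi_mx_rank x k (A : 'M[C]_N) (e : C) : vdom k x -> e * e = 1 ->
  (forall u, chi (vframe k x u) = vframe k x (A *m u)) ->
  A *m A = 1%:M /\ (\rank (1%:M + e *: A)%R).*2 = N.
Proof.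
move=> xk ee AE.
have AA : A *m A = 1%:M.
  by apply: (frame_mx_inj xk) => u; rewrite -mulmxA -!AE chiK mul1mx.
split=> //.
have [T [lT [c c0 TT] _ Tv _]] := vol_swap x.
have [B BE] := linear_frame_mx xk lT.
have two0 : 2%:R != 0 :> C by rewrite pnatr_eq0.
apply: (@involution_rank _ two0 _ _ B c) => //.
- by rewrite -scalemxAl -scalemxAr scalerA ee scale1r.
- apply: (frame_mx_inj xk) => u; rewrite -mulmxA -!BE TT mul_scalar_mx.
  by rewrite linearZ.
- rewrite -scalemxAr -scalemxAl -scalerN; congr (_ *: _).
  apply: (frame_mx_inj xk) => u; rewrite mulNmx linearN -!mulmxA -BE -!AE -BE.
  by rewrite /chi (linear_funZ lT) Tv scalerN.
Qed.

Lemma Sigma_rank_gt0 (x : M) : (0 < N)%N.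
Proof.
rewrite lt0n; apply/eqP => N0; have [u u0] := Sigma_nontrivial x.
have [k xk] := vdom_cover Sigma x; have [f _ fK] := vframe_bij xk.
apply: u0; rewrite -[u]fK (_ : f u = 0) ?linear0 //.
apply/colP => i; exfalso.
have : (i < 0)%N by rewrite -[X in (_ < X)%N]N0 ltn_ord.
by rewrite ltn0.
Qed.

(** In a frame, [chi] is a smooth matrix [A] with square 1, and the eigenspace
    for [e] is the range of [1 + e *: A], which has constant rank [r]. The
    products of this matrix with [r] fixed vectors that give a basis at [x0]
    remain independent near [x0]. *)
Lemma chi_local_frame (e : C) (r : nat) x0 : e * e = 1 -> r.*2 = N ->
  exists f : local_frame r (chi_space e), lf_dom f x0.
Proof.
move=> ee rN; have [k xk] := vdom_cover Sigma x0.
pose i := chart_idx_at x0; have xi : dom (atlas i) x0 := chart_idx_atP x0.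
have [W [s [Wo Wx Wi ss chiE]]] := chi_coef_smooth xi.
have [a [as_ aE]] := frame_vol_smooth i k.
pose W1 := W `&` vdom k.
have W1o : open W1 by apply: openI => //; exact: vdom_open.
pose A y := s y *: a y.
have As : cmsmooth W1 A.
  apply: cmsmoothZ => //; first by apply: csmooth_sub ss => y [].
  by apply: cmsmooth_sub as_ => y [/Wi yi yk].
have AE y u : W1 y -> chi (vframe k y u) = vframe k y (A y *m u).
  move=> [yW yk]; have [_ _ tZ _ _] := htau.1 y.
  rewrite /A -scalemxAl linearZ -aE ?frame_volE ?tZ //; last exact: Wi.
  by rewrite /= scalerA -chiE.
have pi_rank y : W1 y -> A y *m A y = 1%:M /\ \rank (1%:M + e *: A y)%R = r.
  move=> Wy; have [AA rk] := chi_mx_rank Wy.2 ee (fun u => AE y u Wy).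
  by split=> //; apply: double_inj; rewrite rN.
have x0W : W1 x0 by [].
have [U Ui] := full_col_factor (pi_rank x0 x0W).2.
pose F y := (1%:M + e *: A y) *m U.
have Fs : cmsmooth W1 F.
  apply: cmsmoothM => //; last exact: cmsmooth_cst.
  apply: cmsmoothD => //; first exact: cmsmooth_cst.
  by apply: cmsmoothZ => //; exact: csmooth_cst.
pose d y := \det (adjmx (F y) *m F y).
have ds : csmooth W1 d.
  by apply: csmooth_det => //; apply: cmsmoothM => //; exact: cmsmooth_adj.
pose V := W1 `&` [set y | d y != 0].
have Vo : open V.
  rewrite openE => y [Wy dy]; apply: filterI; first exact: open_nbhs_nbhs.
  exact: csmooth_neq0_near W1o ds Wy dy.
have x0V : V x0.
  by split=> //=; rewrite -unitfE -unitmxE; exact: adjmx_unit.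
have Vk : V `<=` vdom k by move=> y [[_ yk] _].
have FsV : cmsmooth V F by apply: cmsmooth_sub Fs => y [].
have FiV y : V y -> col_inj (F y).
  move=> [_ /=]; rewrite /d -unitfE -unitmxE => Fu u Fu0.
  have FFu0 : adjmx (F y) *m F y *m u = 0 by rewrite -mulmxA Fu0 mulmx0.
  by rewrite -[u](mulKmx Fu) FFu0 mulmx0.
have FrV y : V y -> @chi_space e y = range (fun u => vframe k y (F y *m u)).
  move=> Vy; have Wy := Vy.1; have [AA rk] := pi_rank y Wy.
  have AF : A y *m F y = e *: F y.
    rewrite /F mulmxA scalemxAl; congr (_ *m _).
    by rewrite mulmxDr mulmx1 -scalemxAr AA scalerDr scalerA ee scale1r addrC.
  apply/seteqP; split=> [p|_ [u _ <-]]; last first.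
    by rewrite /chi_space /= AE // mulmxA AF -scalemxAl linearZ.
  rewrite /chi_space /= => pE.
  have [X XE] : exists X : 'M[C]_(r, N), (1%:M + e *: A y)%R = F y *m X.
    have sub : ((F y)^T <= (1%:M + e *: A y)%R^T)%MS.
      by rewrite /F trmx_mul submxMl.
    have := mxrank_leqif_sup sub; rewrite !mxrank_tr rk (col_inj_rank (FiV y Vy)).
    move=> [_ /esym]; rewrite eqxx => /submxP[Y YE].
    by exists Y^T; rewrite -[LHS]trmxK YE trmx_mul trmxK.
  have [f _ fK] := vframe_bij Wy.2.
  exists (2^-1 *: (X *m f p)) => //.
  rewrite -scalemxAr mulmxA -XE linearZ mulmxDl mul1mx -scalemxAl linearD linearZ /=.
  rewrite -[vframe k y (A y *m _)]AE // fK pE scalerA ee scale1r.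
  exact: half_double.
by exists (@LocalFrame _ _ _ _ _ _ V k F Vo Vk FsV FiV FrV).
Qed.

Lemma sign_decomposable : decomposable (@Cld R m M g) tau.
Proof.
(* Over an empty manifold nothing bounds [N] below, while the summands must have
   positive rank. *)
pose r := maxn 1 N./2.
have rN (x : M) : r.*2 = N.
  have [k xk] := vdom_cover Sigma x.
  have [A AE] := linear_frame_mx xk (@chi_linear x).
  have [_ rk] := chi_mx_rank xk (mulr1 1) AE.
  have N0 := Sigma_rank_gt0 x.
  have rE : \rank (1%:M + 1 *: A)%R = N./2 by rewrite -[in RHS]rk doubleK.
  rewrite -[in RHS]rk rE /r; congr _.*2; apply/maxn_idPr.
  by rewrite -double_gt0 -[N./2]rE rk.
have ep (x : M) := chi_local_frame x (mulr1 (1 : C)) (rN x).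
have em (x : M) := chi_local_frame x (etrans (mulrNN 1 1) (mulr1 (1 : C))) (rN x).
have [P [iP [Pr lP iPi EP sP]]] := subbundle_exists ep.
have [Q [iQ [Qr lQ iQi EQ sQ]]] := subbundle_exists em.
have iPE x p : chi (iP x p) = iP x p.
  have : @chi_space 1 x (iP x p) by rewrite EP; exists p.
  by rewrite /chi_space /= scale1r.
have iQE x p : chi (iQ x p) = - iQ x p.
  have : @chi_space (-1) x (iQ x p) by rewrite EQ; exists p.
  by rewrite /chi_space /= scaleN1r.
have iPex x u : chi u = u -> exists p, u = iP x p.
  move=> uE; have : @chi_space 1 x u by rewrite /chi_space /= scale1r.
  by rewrite EP => -[p _ <-]; exists p.
have iQex x u : chi u = - u -> exists p, u = iQ x p.
  move=> uE; have : @chi_space (-1) x u by rewrite /chi_space /= scaleN1r.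
  by rewrite EQ => -[p _ <-]; exists p.
have lchi := chi_linear.
exists P, Q, iP, iQ; split=> //.
- by rewrite Pr Qr !leq_max.
- move=> x.
  have surj (u : Sigma x) : exists w : P x * Q x, iP x w.1 + iQ x w.2 = u.
    have [p pE] : exists p, 2^-1 *: (u + chi u) = iP x p.
      apply: iPex; rewrite (linear_funZ (lchi x)) (linear_funD (lchi x)) chiK.
      by rewrite addrC.
    have [q uqE] : exists q, 2^-1 *: (u - chi u) = iQ x q.
      apply: iQex; rewrite (linear_funZ (lchi x)) (linear_funD (lchi x)).
      by rewrite (linear_funN (lchi x)) chiK -scalerN opprB.
    exists (p, q); rewrite /= -pE -uqE -scalerDr addrACA subrr addr0.
    exact: half_double.
  have [h hE] := choice surj; exists h => [[p q]|u]; last exact: hE.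
  have := hE (iP x p + iQ x q); case: (h _) => p' q' /= pq.
  have chipq := congr1 (@chi x) pq.
  rewrite !(linear_funD (lchi x)) !iPE !iQE in chipq.
  have pp : iP x p' = iP x p.
    rewrite -[LHS]half_double -[RHS]half_double; congr (_ *: _).
    have := congr2 +%R pq chipq; rewrite addrACA subrr addr0 => ->.
    by rewrite addrACA subrr addr0.
  move: pq; rewrite pp => /addrI qq.
  by congr (_, _); [exact: iPi|exact: iQi].
- move=> x a Sa; split=> p.
    by apply: iPex; rewrite -chi_commutes // iPE.
  have [tl _ _ _ _] := htau.1 x.
  by apply: iQex; rewrite -chi_commutes // iQE (linear_funN (tl a I)).
Qed.

End FromOrientation.

End VolumeField.

Theorem theorem4 (R : realType) (m : nat) (hm : (0 < m)%N)
  (M : manifold R m) (hM : connected [set: M]%classic) (g : metric M)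
  (Sigma : cvbundle M) (tau : forall x : M, Clg g x -> Sigma x -> Sigma x)
  (htau : algebra_bundle_hom tau)
  (htype : forall x : M,
     if odd m then Cartan_type m./2 (tau x) else Dirac_type m./2 (tau x)) :
  decomposable (@Cld R m M g) tau <-> orientable M.
Proof.
split=> [dec|/orientable_sign[ o o_sign]].
  have [ o o_sign] := decomposable_sign hm htau htype dec.
  exact: (sign_orientable hm o_sign).
exact: (sign_decomposable hm htau htype o_sign).
Qed.
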